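(* For every integer $k$ with $0\le k\le r$, the following identity holds in the conormal Chow ring $A_{M,M^\perp}$: \[ \gamma^k\,\delta^{\,n-k-1}\;=\;\sum_{B} x_{\mathcal F^+(B)\,|\,\mathcal G^+(B)}, \] where the sum runs over all nbc bases $B$ of $M$ with $|\mathrm{IA}(B)|=k+1$.
   Context: Let $M$ be a matroid with no loops and no coloops on the ground set $E=\{0,1,\dots,n\}$, totally ordered by the usual order of integers, of rank $r+1$; its dual $M^\perp$ has rank $n-r$. Write $\mathrm{cl}$, $\mathrm{cl}^\perp$ for the closure operators of $M$, $M^\perp$. A biflat of $M$ is a pair $F|G$ where $F$ is a flat of $M$, $G$ is a flat of $M^\perp$, both are nonempty, they are not both equal to $E$, and $F\cup G=E$. Two biflats $F|G$, $F'|G'$ are compatible if ($F\subseteq F'$ and $G\supseteq G'$) or ($F\supseteq F'$ and $G\subseteq G'$). A biflag is a set $\mathcal F|\mathcal G$ of pairwise compatible biflats with $\bigcup_{F|G\in\mathcal F|\mathcal G}(F\cap G)\neq E$; its length is its number of biflats. The biflats of a biflag of length $m$ can be indexed $F_1|G_1,\dots,F_m|G_m$ with $F_1\subseteq\cdots\subseteq F_m$ and $G_1\supseteq\cdots\supseteq G_m$. Conormal Chow ring: let $S$ be the polynomial ring over $\mathbb R$ in variables $x_{F|G}$, one for each biflat $F|G$; for a set $\mathcal F|\mathcal G$ of biflats put $x_{\mathcal F|\mathcal G}=\prod_{F|G\in\mathcal F|\mathcal G}x_{F|G}$. For $i\in E$ let $\gamma_i=\sum_{i\in F,\,F\neq E}x_{F|G}$,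 $\bar\gamma_i=\sum_{i\in G,\,G\neq E}x_{F|G}$, $\delta_i=\sum_{i\in F\cap G}x_{F|G}$ (sums over biflats). Let $I$ be the ideal generated by the monomials $x_{\mathcal F|\mathcal G}$ for sets $\mathcal F|\mathcal G$ of biflats that are not biflags, and $J$ the ideal generated by all $\gamma_i-\gamma_j$ and $\bar\gamma_i-\bar\gamma_j$. The conormal Chow ring is $A_{M,M^\perp}=S/(I+J)$; the classes of $\gamma_i$ and of $\delta_i$ in it do not depend on $i$ and are denoted $\gamma$ and $\delta$. Activities: for a basis $B$ of $M$ and $i\in B$, let $C^\perp(B,i)$ be the unique cocircuit of $M$ contained in $(E-B)\cup i$ and containing $i$; for $i\notin B$ let $C(B,i)$ be the unique circuit contained in $B\cup i$ and containing $i$. $\mathrm{IA}(B)=\{i\in B: i=\min C^\perp(B,i)\}$ and $\mathrm{EA}(B)=\{i\notin B: i=\min C(B,i)\}$. $B$ is an nbc basis if $\mathrm{EA}(B)=\emptyset$. Extended nbc biflag: for an nbc basis $B$ with $|\mathrm{IA}(B)|=k+1$, write $\mathrm{IA}(B)=\{c_1>\cdots>c_{k+1}\}$, $S_B=B-\mathrm{IA}(B)=\{e_1>\cdots>e_{r-k}\}$, and $T_B=(E-B)-\min(E-B)=\{e_{r-k+1}<\cdots<e_{n-k-1}\}$. Let $i$ be the smallest index with $\mathrm{cl}(S_B\cup\{c_1,\dots,c_i\})\cup\mathrm{cl}^\perp(T_B)=E$. Then $\mathcal F^+(B)|\mathcal G^+(B)$ is the biflag of length $n-1$ with biflats $F^+_j|G^+_j$,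 $1\le j\le n-1$, given by: $\mathrm{cl}\{e_1,\dots,e_j\}\,|\,E$ for $1\le j\le r-k$; $\mathrm{cl}(S_B\cup\{c_1,\dots,c_{j-(r-k)}\})\,|\,E$ for $1\le j-(r-k)\le i-1$; $\mathrm{cl}(S_B\cup\{c_1,\dots,c_{j-(r-k)}\})\,|\,\mathrm{cl}^\perp(T_B)$ for $i\le j-(r-k)\le k$; $E\,|\,\mathrm{cl}^\perp\{e_{j-k},e_{j-k+1},\dots,e_{n-k-1}\}$ for $r+1\le j\le n-1$. *)

(* Defs.v *)
From HB Require Import structures.
From mathcomp Require Import all_boot all_order all_algebra.
From mathcomp Require Import mpoly.
Set Implicit Arguments. Unset Strict Implicit. Unset Printing Implicit Defensive.
Import GRing.Theory.
Local Open Scope ring_scope.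

Section Matroid.
Variable n : nat.
Local Notation E := 'I_n.+1.
Variable bases : {set {set E}}.

Definition is_matroid_bases : Prop :=
  bases != set0 /\
  forall B1 B2, B1 \in bases -> B2 \in bases -> forall x, x \in B1 :\: B2 ->
    exists2 y, y \in B2 :\: B1 & (y |: (B1 :\ x)) \in bases.

Definition mrank (A : {set E}) : nat := \max_(B in bases) #|A :&: B|.
Definition mcl (A : {set E}) : {set E} := [set x | mrank (x |: A) == mrank A].
Definition is_flat (A : {set E}) : bool := mcl A == A.

Definition indep (A : {set E}) : bool := [exists B in bases, A \subset B].
Definition is_circuit (C : {set E}) : bool :=
  ~~ indep C && [forall D : {set E}, (D \proper C) ==> indep D].

End Matroid.

Section Conormal.
Variable n : nat.
Local Notation E := 'I_n.+1.
Variable bases : {set {set E}}.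

Definition dual_bases : {set {set E}} := [set ~: B | B in bases].
Definition cl := mcl bases.
Definition clp := mcl dual_bases.
Definition is_cocircuit (C : {set E}) : bool := is_circuit dual_bases C.

Definition is_biflat (p : {set E} * {set E}) : bool :=
  [&& is_flat bases p.1, is_flat dual_bases p.2, p.1 != set0, p.2 != set0,
      ~~ ((p.1 == setT) && (p.2 == setT)) & p.1 :|: p.2 == setT].

Definition compatible (p q : {set E} * {set E}) : bool :=
  ((p.1 \subset q.1) && (q.2 \subset p.2)) || ((q.1 \subset p.1) && (p.2 \subset q.2)).

Definition is_biflag (S : {set {set E} * {set E}}) : bool :=
  [forall p in S, is_biflat p] &&
  [forall p in S, forall q in S, compatible p q] &&
  (\bigcup_(p in S) (p.1 :&: p.2) != setT).

Definition biflatT := {p : {set E} * {set E} | is_biflat p}.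
Definition nvars : nat := #|{: biflatT}|.

Variable R : comNzRingType.
Definition Spoly := {mpoly R[nvars]}.

(* The variable x_{F|G}; pairs that are not biflats are sent to 0
   (this default is never used for biflats). *)
Definition xvar (p : {set E} * {set E}) : Spoly :=
  match insub p with
  | Some b => 'X_(enum_rank (b : biflatT))
  | None => 0
  end.

Definition xmon (S : {set {set E} * {set E}}) : Spoly := \prod_(p in S) xvar p.

Definition gam (i : E) : Spoly :=
  \sum_(p | is_biflat p && (i \in p.1) && (p.1 != setT)) xvar p.
Definition gambar (i : E) : Spoly :=
  \sum_(p | is_biflat p && (i \in p.2) && (p.2 != setT)) xvar p.
Definition del (i : E) : Spoly :=
  \sum_(p | is_biflat p && (i \in p.1 :&: p.2)) xvar p.

Definition Igen (f : Spoly) : Prop :=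
  exists S : {set {set E} * {set E}},
    [/\ (forall p, p \in S -> is_biflat p), ~~ is_biflag S & f = xmon S].
Definition Jgen (f : Spoly) : Prop :=
  exists i j : E, f = gam i - gam j \/ f = gambar i - gambar j.

Definition in_ideal (gen : Spoly -> Prop) (f : Spoly) : Prop :=
  exists s : seq (Spoly * Spoly),
    (forall c, c \in s -> gen c.2) /\ f = \sum_(c <- s) c.1 * c.2.

Definition chow_eq (f g : Spoly) : Prop :=
  in_ideal (fun h => Igen h \/ Jgen h) (f - g).

End Conormal.

Local Close Scope ring_scope.
Section Activities.
Variable n : nat.
Local Notation E := 'I_n.+1.
Variable bases : {set {set E}}.

Definition is_min (i : E) (C : {set E}) : bool :=
  (i \in C) && [forall x in C, (i <= x)%N].

(* IA(B): i in B minimal in the (unique) cocircuit C^perp(B,i) contained in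
   (E - B) cup i and containing i. *)
Definition IA (B : {set E}) : {set E} :=
  [set i in B | [exists C, [&& is_cocircuit bases C, C \subset i |: ~: B
                             & is_min i C]]].
(* EA(B): i not in B minimal in the (unique) circuit C(B,i) contained in
   B cup i and containing i. *)
Definition EA (B : {set E}) : {set E} :=
  [set i in ~: B | [exists C, [&& is_circuit bases C, C \subset i |: B
                               & is_min i C]]].
Definition nbc_basis (B : {set E}) : bool := (B \in bases) && (EA B == set0).

Definition sort_dec (A : {set E}) : seq E := sort (fun x y : E => (y <= x)%N) (enum A).
Definition sort_inc (A : {set E}) : seq E := sort (fun x y : E => (x <= y)%N) (enum A).

Definition set_of (s : seq E) : {set E} := [set x in s].

Variables (r k : nat).
Variable B : {set E}.

Definition cseq : seq E := sort_dec (IA B).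
Definition SB : {set E} := B :\: IA B.
Definition TB : {set E} :=
  let D := ~: B in
  match [pick x in D | is_min x D] with Some m => D :\ m | None => D end.
(* e_1 > ... > e_{r-k} (elements of S_B), then e_{r-k+1} < ... < e_{n-k-1} (T_B) *)
Definition eseq : seq E := sort_dec SB ++ sort_inc TB.

Definition iB : nat :=
  find (fun i => cl bases (SB :|: set_of (take i cseq)) :|: clp bases TB == setT)
       (iota 0 (k.+2)).

Definition Fplus (j : nat) : {set E} * {set E} :=
  if (j <= r - k)%N then (cl bases (set_of (take j eseq)), setT)
  else if (j <= r)%N then
    let m := j - (r - k) in
    (cl bases (SB :|: set_of (take m cseq)),
     if (m <= iB - 1)%N then setT else clp bases TB)
  else (setT, clp bases (set_of (drop (j - k - 1) eseq))).

Definition ext_biflag : {set {set E} * {set E}} :=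
  [set Fplus (nat_of_ord j) | j : 'I_n & 0 < j].

End Activities.

(* Main.v *)
Require Import Defs.
From HB Require Import structures.
From mathcomp Require Import all_boot all_order all_algebra.
From mathcomp Require Import mpoly zify.
From mathcomp Require Import reals.
Set Implicit Arguments. Unset Strict Implicit. Unset Printing Implicit Defensive.
Import GRing.Theory.

(* Write S, T for disjoint independent sets of M and of its dual. Expanding one factor delta at
   a time, always through the largest element e that no F meet G of the current biflag contains,
   each new biflat receives e as its label. Call a biflag split when each of its biflats is F|E
   or E|G. Counting labels shows that gamma^k kills every term containing a proper flat F with
   an element that is never used as a label: for T independent in the dual and F of rank at most
   r - k, the n - k - 1 labels leave no room for it. A biflat with both parts proper leads to
   such an element, because the step between two biflats never leaves exactly one element
   uncovered. Hence modulo the annihilator of gamma^k, a split biflag with labels S, T times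
   delta is the sum of the two split biflags with labels S + e, T and S, T + e. The final label
   sets are exactly the pairs (S_B, T_B), with B the complement of T + m for m the largest
   uncovered element: max-first insertion translates into the activity conditions. Finally,
   multiplying by gamma through c_1 > c_2 > ... adds one forced biflat at a time. *)

(** * Rank and closure of a matroid given by its bases *)

(** For a basis $B$ join $b\in B$ to $e\notin B$ when $e+B-b$ is again a basis. This one bipartite
    graph carries the combinatorics. For $S\subseteq B$ an element outside $B$ lies in
    $\mathrm{cl}(S)$ iff all its neighbours lie in $S$; for $T\subseteq E-B$ an element of $B$ lies
    in $\mathrm{cl}^\perp(T)$ iff all its neighbours lie in $T$; an element is active iff it is
    smaller than all its neighbours. So the greedy choice of labels and the activities are compared
    edge by edge. The numbers are tight. Under $\gamma^k$ a proper flat survives only in rank at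
    most $r-k$, and the $G$ of the biflats $E|G$ have rank at most $n-r-1$, since some element stays
    uncovered. These bounds add up to the exponent $n-k-1$ of $\delta$, so a flat whose rank once
    exceeds its number of labels can never be caught up with. This is why $\gamma^k$ stays as a
    factor while all the $\delta$ are expanded, and is itself expanded only afterwards. *)

Section MatroidTheory.
Variable n : nat.
Local Notation E := 'I_n.+1.
Implicit Types (A I J B : {set E}) (x y z : E).

Section OneMatroid.
Variables (bases : {set {set E}}) (rho : nat).
Hypothesis bases_matroid : is_matroid_bases bases.
Hypothesis bases_card : forall B, B \in bases -> #|B| = rho.
Local Notation rk := (mrank bases).
Local Notation cl := (mcl bases).
Local Notation indep := (indep bases).
Local Notation flat := (is_flat bases).

Lemma indepP I : reflect (exists2 B, B \in bases & I \subset B) (indep I).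
Proof.
apply: (iffP existsP) => [[B /andP[? ?]]|[B ? ?]]; first by exists B.
by exists B; apply/andP.
Qed.

Lemma indepS I J : I \subset J -> indep J -> indep I.
Proof.
by move=> sIJ /indepP[B bB sJB]; apply/indepP; exists B => //; apply: subset_trans sJB.
Qed.

Lemma base_indep B : B \in bases -> indep B.
Proof. by move=> bB; apply/indepP; exists B. Qed.

(** Among the bases containing [I], one that meets [B] in the most elements works: an element of it
    outside both [I] and [B] could be exchanged for an element of [B]. *)
Lemma base_extend I B : indep I -> B \in bases ->
  exists2 B', B' \in bases & (I \subset B') && (B' \subset I :|: B).
Proof.
move=> /indepP[B0 bB0 sIB0] bB.
pose P := [pred X : {set E} | (X \in bases) && (I \subset X)].
have PB0 : P B0 by rewrite /= bB0 sIB0.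
case: (arg_maxnP (fun X : {set E} => #|X :&: B|) PB0) => B' /andP[bB' sIB'] maxB'.
exists B' => //; rewrite sIB'; apply/subsetP => z zB'; rewrite inE.
case: (boolP (z \in I)) => //= zI; apply/negPn/negP => zB.
have zD : z \in B' :\: B by rewrite inE zB zB'.
have [y yD by'] := (bases_matroid.2 _ _ bB' bB _ zD).
have {}yD : y \in B /\ y \notin B' by move: yD; rewrite inE => /andP[].
have PX : P (y |: (B' :\ z)).
  rewrite /= by'; apply/subsetP => w wI; rewrite !inE (subsetP sIB' _ wI) andbT.
  by apply/orP; right; apply: contraNneq zI => <-.
have := maxB' _ PX; apply/negP; rewrite -ltnNge.
have -> : (y |: B' :\ z) :&: B = y |: (B' :&: B).
  apply/setP => w; rewrite !inE.
  case: (eqVneq w y) => [->|_] /=; first by rewrite yD.1.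
  by case: (eqVneq w z) => [->|_] //=; rewrite (negPf zB) andbF.
by rewrite cardsU1 inE (negPf yD.2).
Qed.

(** Extend [I] to a basis by elements of a basis [BJ] containing [J]. As [I] is smaller than [J],
    more elements are added than [BJ :\: J] has, so one of them lies in [J]. *)
Lemma indep_augment I J : indep I -> indep J -> #|I| < #|J| ->
  exists2 y, y \in J :\: I & indep (y |: I).
Proof.
move=> iI /indepP[BJ bBJ sJ] ltIJ.
have [B1 bB1 /andP[sI sB1]] := base_extend iI bBJ.
have /subsetPn[y yD yND] : ~~ (B1 :\: I \subset BJ :\: J).
  apply/negP => /subset_leq_card; rewrite !cardsD.
  rewrite (setIidPr sI) (setIidPr sJ) (bases_card bB1) (bases_card bBJ).
  have := subset_leq_card sI; rewrite (bases_card bB1).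
  have := subset_leq_card sJ; rewrite (bases_card bBJ). lia.
move: yD yND; rewrite !inE => /andP[yI yB1].
have := subsetP sB1 _ yB1; rewrite inE (negPf yI) /= => ->; rewrite andbT negbK => yJ.
exists y; first by rewrite inE yI.
by apply/indepP; exists B1 => //; rewrite subUset sub1set yB1.
Qed.

Lemma indep_rk I A : indep I -> I \subset A -> #|I| <= rk A.
Proof.
move=> /indepP[B bB sIB] sIA.
apply: (bigmax_sup B) => //.
by apply: subset_leq_card; rewrite subsetI sIA.
Qed.

Lemma rk_witness A : exists I, [/\ indep I, I \subset A & #|I| = rk A].
Proof.
have b0 : 0 < #|bases| by rewrite card_gt0; case: bases_matroid.
have [B bB eB] := eq_bigmax_cond (fun B : {set E} => #|A :&: B|) b0.
exists (A :&: B); split; rewrite ?subsetIl //.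
by apply/indepP; exists B; rewrite ?subsetIr.
Qed.

Lemma rk_extend I A : indep I -> I \subset A ->
  exists J, [/\ indep J, I \subset J, J \subset A & #|J| = rk A].
Proof.
move=> iI sIA.
pose P := [pred X : {set E} | [&& indep X, I \subset X & X \subset A]].
have PI : P I by rewrite /= iI sIA subxx.
case: (arg_maxnP (fun X : {set E} => #|X|) PI) => J /and3P[iJ sIJ sJA] maxJ.
exists J; split=> //; apply/eqP; rewrite eqn_leq indep_rk //=.
rewrite leqNgt; apply/negP => ltJ.
have [K [iK sKA cK]] := rk_witness A; rewrite -cK in ltJ.
have [y] := indep_augment iJ iK ltJ; rewrite inE => /andP[yJ yK] iyJ.
have := maxJ (y |: J); rewrite /= iyJ subUset sub1set (subsetP sKA _ yK) sJA.
by rewrite (subset_trans sIJ (subsetUr _ _)) cardsU1 yJ => /(_ isT); rewrite ltnn.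
Qed.

Lemma rk_le_card A : rk A <= #|A|.
Proof. by have [I [_ sI <-]] := rk_witness A; apply: subset_leq_card. Qed.

Lemma rk_indep I : indep I -> rk I = #|I|.
Proof. by move=> iI; apply/eqP; rewrite eqn_leq rk_le_card indep_rk. Qed.

Lemma rk_mono A B : A \subset B -> rk A <= rk B.
Proof.
by move=> sAB; have [I [iI sI <-]] := rk_witness A; apply: indep_rk (subset_trans sI sAB).
Qed.

Lemma rk_max A : rk A <= rho.
Proof.
have [I [/indepP[B bB sIB] _ <-]] := rk_witness A.
by rewrite -(bases_card bB) subset_leq_card.
Qed.

Lemma rk_setT : rk setT = rho.
Proof.
have /set0Pn[B bB] := bases_matroid.1.
apply/eqP; rewrite eqn_leq rk_max -(bases_card bB) indep_rk //.
exact: base_indep.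
Qed.

Lemma mem_cl x A : (x \in cl A) = (rk (x |: A) == rk A).
Proof. by rewrite inE. Qed.

Lemma indep_setU1 x I : indep I -> x \notin cl I -> indep (x |: I).
Proof.
move=> iI; rewrite mem_cl => nx.
have [J [iJ sIJ sJ cJ]] := rk_extend iI (subsetUr [set x] I).
have ltI : rk I < rk (x |: I) by rewrite ltn_neqAle eq_sym nx rk_mono ?subsetUr.
have -> // : x |: I = J.
apply/esym/eqP; rewrite eqEcard sJ cJ.
rewrite cardsU1; apply: leq_trans ltI; rewrite (rk_indep iI).
by case: (x \notin I); rewrite ?add1n ?add0n.
Qed.

Lemma indep_notin_cl x I : x \notin I -> indep (x |: I) -> x \notin cl I.
Proof.
move=> xI ixI; rewrite mem_cl (rk_indep ixI) (rk_indep (indepS (subsetUr _ _) ixI)).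
by rewrite cardsU1 xI; lia.
Qed.

Lemma sub_cl A : A \subset cl A.
Proof. by apply/subsetP => x xA; rewrite mem_cl (setUidPr _) ?sub1set. Qed.

Lemma clS A B : A \subset B -> cl A \subset cl B.
Proof.
move=> sAB; apply/subsetP => x xA; apply/negPn/negP => xB.
have xNB : x \notin B by apply: contraNN xB => /(subsetP (sub_cl B)).
have [I [iI sIA cI]] := rk_witness A.
have [J [iJ sIJ sJB cJ]] := rk_extend iI (subset_trans sIA sAB).
have xJ : x \notin cl J.
  rewrite mem_cl; apply: contraNN xB => /eqP xJ; rewrite mem_cl eq_sym eqn_leq rk_mono ?subsetUr //=.
  have [K [iK sJK sK cK]] := rk_extend iJ (subset_trans sJB (subsetUr [set x] B)).
  rewrite -cK -cJ leqNgt; apply/negP => ltJK.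
  have [y yD iy] := indep_augment iJ iK ltJK.
  move: yD; rewrite inE => /andP[yJ yK].
  have := subsetP sK _ yK; rewrite !inE => /orP[/eqP yx|yB].
    by move: iy; rewrite yx in yJ *; move/(indep_notin_cl yJ); rewrite mem_cl xJ eqxx.
  have syB : y |: J \subset B by rewrite subUset sub1set yB sJB.
  by have := indep_rk iy syB; rewrite cardsU1 yJ -cJ add1n ltnn.
have xI := indepS (setUS [set x] sIJ) (indep_setU1 iJ xJ).
have xnI : x \notin I by apply: contraNN xNB => /(subsetP (subset_trans sIA sAB)).
have := indep_rk xI (setUS [set x] sIA).
by rewrite cardsU1 xnI cI; move: xA; rewrite mem_cl => /eqP->; rewrite add1n ltnn.
Qed.

Lemma rk_cl A : rk (cl A) = rk A.
Proof.
apply/eqP; rewrite eqn_leq (rk_mono (sub_cl A)) andbT.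
have [I [iI sIA cI]] := rk_witness A.
have [J [iJ sIJ sJB cJ]] := rk_extend iI (subset_trans sIA (sub_cl A)).
rewrite -cJ -cI leqNgt; apply/negP => lt.
have [y] := indep_augment iI iJ lt; rewrite inE => /andP[yI yJ] iy.
have := subsetP sJB _ yJ; rewrite mem_cl => /eqP e.
have := indep_rk iy (setUS [set y] sIA); rewrite cardsU1 yI e cI; lia.
Qed.

Lemma cl_flat A : flat (cl A).
Proof.
rewrite /is_flat eqEsubset sub_cl andbT; apply/subsetP => x.
rewrite !mem_cl rk_cl => /eqP xA; rewrite eq_sym eqn_leq rk_mono ?subsetUr //= -xA.
by rewrite rk_mono // setUS // sub_cl.
Qed.

Lemma flat_cl A : flat A -> cl A = A.
Proof. by move/eqP. Qed.

Lemma flat_clS A B : A \subset B -> flat B -> cl A \subset B.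
Proof. by move=> sAB /eqP <-; apply: clS. Qed.

Lemma flat_rk_setU1 x A : flat A -> x \notin A -> rk A < rk (x |: A).
Proof.
move=> /eqP fA xA; rewrite ltn_neqAle rk_mono ?subsetUr // andbT eq_sym.
by rewrite -mem_cl fA.
Qed.

Lemma flat_rk_eq A B : flat A -> A \subset B -> rk B <= rk A -> A = B.
Proof.
move=> fA sAB leBA; apply/eqP; rewrite eqEsubset sAB; apply/subsetP => x xB.
apply/negPn/negP => /(flat_rk_setU1 fA); apply/negP; rewrite -leqNgt.
by apply: leq_trans leBA; rewrite rk_mono // subUset sub1set xB.
Qed.

Lemma flat_rk_lt A : flat A -> A != setT -> rk A < rho.
Proof.
move=> fA; apply: contraNT; rewrite -leqNgt => le.
by apply/eqP/(flat_rk_eq fA (subsetT _)); rewrite rk_setT.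
Qed.

Lemma cl_neqT I : indep I -> #|I| < rho -> cl I != setT.
Proof.
by move=> iI lt; apply: contraTneq lt => e; rewrite -(rk_indep iI) -rk_cl e rk_setT ltnn.
Qed.

Lemma cl_setU1 x A F : flat F -> A \subset F -> x \in F -> cl (x |: A) \subset F.
Proof. by move=> fF sAF xF; apply: flat_clS; rewrite // subUset sub1set xF. Qed.

Lemma cl0 : (forall x, exists2 B, B \in bases & x \in B) -> cl set0 = set0.
Proof.
move=> loopless; apply/setP => x; rewrite in_set0; apply/negbTE.
apply: indep_notin_cl; rewrite ?inE // setU0.
by have [B bB xB] := loopless x; apply/indepP; exists B; rewrite ?sub1set.
Qed.

(** A basis between [x |: I] and [x |: B] omits exactly one element of [x |: B], by cardinality. *)
Lemma base_swap I B x : B \in bases -> I \subset B -> x \notin B -> indep (x |: I) ->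
  exists2 b, b \in B :\: I & x |: (B :\ b) \in bases.
Proof.
move=> bB sIB xB ix.
have [B' bB' /andP[sIB' sB']] := base_extend ix bB.
have xB' : x \in B' by apply: (subsetP sIB'); rewrite !inE eqxx.
have sB'B : B' \subset x |: B.
  by apply: subset_trans sB' _; rewrite -setUA (setUidPr sIB).
have c1 : #|(x |: B) :\: B'| = 1.
  rewrite cardsD (setIidPr sB'B) cardsU1 xB (bases_card bB) (bases_card bB'). lia.
have /cards1P[b eb] : #|(x |: B) :\: B'| == 1 by rewrite c1.
have : b \in (x |: B) :\: B' by rewrite eb set11.
rewrite !inE => /andP[bB'N /orP[/eqP bx|bBB]]; first by rewrite bx xB' in bB'N.
exists b; first by rewrite inE bBB andbT; apply: contraNN bB'N => bI; apply: (subsetP sIB'); rewrite !inE bI orbT.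
have -> // : x |: (B :\ b) = B'.
apply/setP => z; apply/idP/idP => [|zB'].
  rewrite !inE => /orP[/eqP->//|/andP[zb zB]]; apply: contraNT zb => zB'.
  by rewrite -in_set1 -eb !inE zB' zB orbT.
have := subsetP sB'B _ zB'; rewrite !inE => /orP[->//|->]; rewrite andbT.
by apply/orP; right; apply: contraNneq bB'N => <-.
Qed.

(** The elements exchangeable with [x] form its fundamental circuit without [x], so membership in
    the closure of a part of [B] becomes a condition on single exchanges. *)
Lemma mem_cl_base I B x : B \in bases -> I \subset B -> x \notin B ->
  (x \in cl I) = [forall b in B, (x |: (B :\ b) \in bases) ==> (b \in I)].
Proof.
move=> bB sIB xB; apply/idP/idP => [xI|].
  apply/forall_inP => b bBB; apply/implyP => bb; apply: contraLR xI => bI.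
  apply: indep_notin_cl; first by apply: contraNN xB => /(subsetP sIB).
  apply: indepS (base_indep bb); rewrite setUS //; apply/subsetP => z zI.
  by rewrite !inE (subsetP sIB _ zI) andbT; apply: contraNneq bI => <-.
apply: contraTT => xI.
have [b] := base_swap bB sIB xB (indep_setU1 (indepS sIB (base_indep bB)) xI).
rewrite inE => /andP[bI bBB] bb.
by apply/forall_inPn; exists b; rewrite // bb.
Qed.

(** The activities quantify existentially over circuits; this exhibits the only possible witness and
    lets activity be read off the exchanges. *)
Lemma fundamental_circuit B x C : B \in bases -> x \notin B ->
  (is_circuit bases C && (C \subset x |: B) && (x \in C)) =
  (C == x |: [set b in B | x |: (B :\ b) \in bases]).
Proof.
move=> bB xB; set K := [set b in B | _].
have sKB : K \subset B by apply/subsetP => b; rewrite inE => /andP[].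
have xK : x \notin K by apply: contraNN xB => /(subsetP sKB).
apply/idP/eqP => [/andP[/andP[/andP[dC /forallP mC] sC] xC]|->].
  apply/setP => b; rewrite !inE; case: (eqVneq b x) => [->//|bx] /=.
  apply/idP/andP => [bC|[bBB bb]]; last first.
    apply: contraNT dC => bC; apply: indepS (base_indep bb).
    apply/subsetP => z zC; rewrite !inE; have := subsetP sC _ zC; rewrite !inE.
    case: eqP => //= _ ->; rewrite andbT; apply: contraNneq bC => <- //.
  have bBB : b \in B by have := subsetP sC _ bC; rewrite !inE (negPf bx).
  split=> //.
  have iCb : indep (x |: (C :\ b :\ x)).
    by rewrite setD1K ?inE 1?eq_sym ?bx ?xC //; apply: (implyP (mC _)); apply: properD1.
  have sCb : C :\ b :\ x \subset B.
    by apply/subsetP => z; rewrite !inE => /and3P[zx _ /(subsetP sC)]; rewrite !inE (negPf zx).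
  have [b' ] := base_swap bB sCb xB iCb.
  rewrite !inE => /andP[nb' b'B] bb'.
  case: (eqVneq b b') => [->//|nbb'].
  have b'C : b' \notin C.
    apply: contraNN nb' => ->; rewrite andbT [b' == b]eq_sym nbb' andbT.
    by apply: contraNneq xB => <-.
  case/negP: dC; apply: indepS (base_indep bb').
  apply/subsetP => z zC; rewrite !inE; have := subsetP sC _ zC; rewrite !inE.
  by case: eqP => //= _ ->; rewrite andbT; apply: contraNneq b'C => <-.
rewrite setUS // setU11 !andbT; apply/andP; split.
  apply/negP => iK; have := indep_notin_cl xK iK; rewrite (mem_cl_base bB) //.
  by case/negP; apply/forall_inP => b bBB; apply/implyP => bb; rewrite inE bBB.
apply/forallP => D; apply/implyP => /properP[sD [z zC zD]].
move: zC; rewrite !inE => /orP[/eqP zx|/andP[zB bz]].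
  apply: indepS (base_indep bB); apply/subsetP => w wD; have := subsetP sD _ wD.
  rewrite !inE => /orP[/eqP wx|/andP[]//]; by rewrite -zx in wx; rewrite -wx wD in zD.
apply: indepS (base_indep bz); apply/subsetP => w wD; have := subsetP sD _ wD.
rewrite !inE; case: eqP => //= _ /andP[->]; rewrite andbT => _.
by apply: contraNneq zD => <-.
Qed.

End OneMatroid.
End MatroidTheory.

(** * Duality and activities *)

Section Activity.
Variables (n r : nat).
Local Notation E := 'I_n.+1.
Variable bases : {set {set E}}.
Hypothesis bases_matroid : is_matroid_bases bases.
Hypothesis bases_card : forall B, B \in bases -> #|B| = r.+1.
Hypothesis coloopless : forall x : E, exists2 B, B \in bases & x \notin B.
Implicit Types (A I B S T : {set E}) (b e f m x y : E).

Local Notation rk := (mrank bases).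
Local Notation rkp := (mrank (dual_bases bases)).
Local Notation cl := (Defs.cl bases).
Local Notation clp := (Defs.clp bases).
Local Notation indep := (Defs.indep bases).
Local Notation indepp := (Defs.indep (dual_bases bases)).
Local Notation flat := (is_flat bases).
Local Notation flatp := (is_flat (dual_bases bases)).

Lemma mem_dual_bases B : (B \in dual_bases bases) = (~: B \in bases).
Proof.
apply/imsetP/idP => [[B' bB' ->]|bB]; first by rewrite setCK.
by exists (~: B); rewrite ?setCK.
Qed.

Lemma dual_bases_matroid : is_matroid_bases (dual_bases bases).
Proof.
split=> [|B1 B2].
  have /set0Pn[B bB] := bases_matroid.1.
  by apply/set0Pn; exists (~: B); rewrite mem_dual_bases setCK.
rewrite !mem_dual_bases => bB1 bB2 x; rewrite inE => /andP[xB2 xB1].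
have iI : indep (x |: (~: B1 :&: ~: B2)).
  apply/indepP; exists (~: B2) => //.
  by rewrite subUset sub1set inE xB2 subsetIr.
have xN : x \notin ~: B1 by rewrite inE negbK.
have [b bD bb] := base_swap bases_matroid bases_card bB1 (subsetIl _ _) xN iI.
move: bD; rewrite !inE => /andP[nb bB1N]; rewrite bB1N /= negbK in nb.
exists b; first by rewrite inE bB1N.
rewrite mem_dual_bases; have -> // : ~: (b |: B1 :\ x) = x |: (~: B1 :\ b).
have xb : x != b by apply: contraNneq bB1N => <-.
apply/setP => z; rewrite !inE; case: (eqVneq z x) => [->|_] /=; first by rewrite (negPf xb).
by rewrite negb_or.
Qed.

Lemma ltn_rank_ground : r < n.
Proof.
have [B bB B0] := coloopless ord0.
have := max_card [pred x in ord0 |: B]; rewrite card_ord.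
by rewrite (_ : #|_| = #|ord0 |: B|) // cardsU1 B0 (bases_card bB).
Qed.

Lemma card_setCS A : #|~: A| = n.+1 - #|A|.
Proof. by rewrite cardsCs setCK card_ord. Qed.

Lemma dual_bases_card B : B \in dual_bases bases -> #|B| = n - r.
Proof. by rewrite mem_dual_bases => /bases_card; rewrite card_setCS; have := max_card B; rewrite card_ord; lia. Qed.

Lemma rk_dual A : rkp A + r.+1 = #|A| + rk (~: A).
Proof.
apply/eqP; rewrite eqn_leq; apply/andP; split.
  have [I [/indepP[B]]] := rk_witness dual_bases_matroid A.
  rewrite mem_dual_bases => bB sIB sIA cI; rewrite -cI -(bases_card bB).
  have iJ : indep (~: B :&: ~: A) by apply/indepP; exists (~: B); rewrite ?subsetIl.
  have := indep_rk iJ (subsetIr _ _).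
  rewrite -(cardsID A (~: B)) setDE => le; rewrite addnA leq_add //.
  rewrite -cardsUI; have /eqP-> : I :&: (~: B :&: A) == set0.
    rewrite -subset0; apply/subsetP => x; rewrite !inE => /and3P[xI xB _].
    by rewrite (subsetP sIB _ xI) in xB.
  by rewrite cards0 addn0 subset_leq_card // subUset sIA subsetIr.
have [I [/indepP[B bB sIB] sIA cI]] := rk_witness bases_matroid (~: A).
have iJ : indepp (~: B :&: A).
  by apply/indepP; exists (~: B); rewrite ?subsetIl // mem_dual_bases setCK.
apply: leq_trans (leq_add (indep_rk iJ (subsetIr _ _)) (leqnn _)).
rewrite -cI -(bases_card bB) -(cardsID (~: B) A) -addnA setIC leq_add2l -cardsUI.
have /eqP-> : (A :\: ~: B) :&: I == set0.
  rewrite -subset0; apply/subsetP => x; rewrite !inE negbK => /andP[/andP[_ xA] xI].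
  by have := subsetP sIA _ xI; rewrite inE xA.
rewrite cards0 addn0 subset_leq_card // subUset sIB andbT.
by apply/subsetP => x; rewrite !inE negbK => /andP[].
Qed.

(** By the dual rank formula, adjoining [x] to [A] keeps the dual rank exactly when removing [x]
    from the complement of [A] lowers the rank. *)
Lemma mem_clp A x : x \notin A -> (x \in clp A) = (x \notin cl (~: A :\ x)).
Proof.
move=> xA; rewrite !mem_cl setD1K ?inE //.
have := rk_dual A; have := rk_dual (x |: A); rewrite cardsU1 xA.
have -> : ~: (x |: A) = ~: A :\ x by apply/setP => z; rewrite !inE negb_or.
have := rk_mono dual_bases_matroid (subsetUr [set x] A).
have := rk_mono bases_matroid (subD1set (~: A) x).
move: (rkp _) (rkp _) (rk _) (rk _) => a b c d /= h1 h2 h3 h4.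
lia.
Qed.

(* The complement of a flat of the dual is a union of circuits, and no circuit leaves a flat in
   a single element. *)
Lemma gap_not_singleton F G x : flat F -> flatp G -> x \notin F -> x \notin G ->
  exists2 y, y != x & (y \notin F) && (y \notin G).
Proof.
move=> fF fG xF xG.
have := mem_clp xG; rewrite /Defs.clp (flat_cl fG) (negPf xG) => /esym/negbFE xcl.
have /subsetPn[y] : ~~ (~: G :\ x \subset F).
  by apply: contraNN xF => sF; apply: (subsetP (flat_clS bases_matroid bases_card sF fF)).
by rewrite !inE => /andP[yx yG] yF; exists y; rewrite ?yF.
Qed.

(** A basis and its complement have the same exchange pairs, so closures in the dual are governed by
    the same relation as those in the matroid. *)
Lemma swapC B b e : b \in B -> e \notin B ->
  (b |: (~: B :\ e) \in dual_bases bases) = (e |: (B :\ b) \in bases).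
Proof.
move=> bB eB; rewrite mem_dual_bases; congr (_ \in bases).
have be : e != b by apply: contraNneq eB => ->.
apply/setP => z; rewrite !inE; case: (eqVneq z e) => [->|_] /=; first by rewrite (negPf be).
by rewrite negb_or negbK.
Qed.

Lemma mem_cl_B B S e : B \in bases -> S \subset B -> e \notin B ->
  (e \in cl S) = [forall b in B, (e |: (B :\ b) \in bases) ==> (b \in S)].
Proof. exact: (mem_cl_base bases_matroid bases_card). Qed.

Lemma mem_clp_B B T b : B \in bases -> T \subset ~: B -> b \in B ->
  (b \in clp T) = [forall e in ~: B, (e |: (B :\ b) \in bases) ==> (e \in T)].
Proof.
move=> bB sT bBB; rewrite (mem_cl_base dual_bases_matroid dual_bases_card (B := ~: B)) //.
- by apply: eq_forallb_in => e; rewrite inE => eB; rewrite swapC.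
- by rewrite mem_dual_bases setCK.
- by rewrite inE bBB.
Qed.

Lemma is_minE x A : is_min x A = (x \in A) && [forall y in A, x <= y].
Proof. by []. Qed.

Lemma mem_EA B x : B \in bases ->
  (x \in EA bases B) =
    (x \notin B) && [forall b in B, (x |: (B :\ b) \in bases) ==> (x < b)].
Proof.
move=> bB; rewrite !inE; case: (boolP (x \in B)) => //= xB.
apply/existsP/forall_inP => [[C /and3P[cC sC /andP[xC mC]]] b bBB|h].
  apply/implyP => bb; have : is_circuit bases C && (C \subset x |: B) && (x \in C).
    by rewrite cC sC.
  rewrite (fundamental_circuit bases_matroid bases_card) // => /eqP eC.
  have bC : b \in C by rewrite eC !inE bBB bb orbT.
  rewrite ltn_neqAle (forall_inP mC) // andbT; apply: contraNneq xB => /val_inj -> //.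
exists (x |: [set b in B | x |: (B :\ b) \in bases]).
have := fundamental_circuit bases_matroid bases_card (x |: [set b in B | x |: (B :\ b) \in bases]) bB xB.
rewrite eqxx => /andP[/andP[-> ->] xC]; rewrite is_minE xC.
apply/forall_inP => b; rewrite !inE => /orP[/eqP->//|/andP[bBB bb]].
by rewrite ltnW // (implyP (h _ bBB)).
Qed.

Lemma mem_IA B x : B \in bases ->
  (x \in IA bases B) =
    (x \in B) && [forall e in ~: B, (e |: (B :\ x) \in bases) ==> (x < e)].
Proof.
move=> bB; rewrite !inE; case: (boolP (x \in B)) => //= xB.
have bB' : ~: B \in dual_bases bases by rewrite mem_dual_bases setCK.
have xB' : x \notin ~: B by rewrite inE xB.
have fc C := fundamental_circuit dual_bases_matroid dual_bases_card C bB' xB'.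
apply/existsP/forall_inP => [[C /and3P[cC sC /andP[xC mC]]] e eB|h].
  rewrite -swapC //; last by rewrite -in_setC.
  apply/implyP => bb; have : is_circuit (dual_bases bases) C && (C \subset x |: ~: B) && (x \in C).
    by rewrite -/(is_cocircuit _ _) cC sC.
  rewrite fc => /eqP eC.
  have bC : e \in C by rewrite eC in_setU1 in_set eB bb orbT.
  rewrite ltn_neqAle (forall_inP mC) // andbT; apply: contraNneq xB' => /val_inj -> //.
exists (x |: [set e in ~: B | x |: (~: B :\ e) \in dual_bases bases]).
have := fc (x |: [set e in ~: B | x |: (~: B :\ e) \in dual_bases bases]).
rewrite /is_cocircuit eqxx => /andP[/andP[-> ->] xC]; rewrite is_minE xC.
apply/forall_inP => e; rewrite in_setU1 in_set => /orP[/eqP->//|/andP[eB bb]].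
by rewrite ltnW // (implyP (h _ eB)) // -swapC // -in_setC.
Qed.

Definition gap S T : {set E} := ~: (cl S :|: clp T).
Definition above x A : {set E} := [set y in A | x < y].

Lemma above_sub x A : above x A \subset A.
Proof. by apply/subsetP => y; rewrite inE => /andP[]. Qed.

Lemma gapS S S' T T' : S \subset S' -> T \subset T' -> gap S' T' \subset gap S T.
Proof.
move=> sS sT; rewrite setCS setUSS //; first exact: (clS bases_matroid bases_card).
exact: (clS dual_bases_matroid dual_bases_card).
Qed.

Lemma gapP S T x : reflect (x \notin cl S /\ x \notin clp T) (x \in gap S T).
Proof. by rewrite in_setC in_setU negb_or; apply: andP. Qed.

Lemma gap_notin S T x : x \in gap S T -> x \notin S :|: T.
Proof.
move=> /gapP[xS xT]; rewrite inE negb_or; apply/andP.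
by split; [apply: contraNN xS | apply: contraNN xT]; apply/subsetP/sub_cl.
Qed.

(* [S] and [T] are what max-first insertion has collected from [SB B] and [TB B] so far. *)
Definition compatible_split B S T : bool :=
  [&& S \subset SB bases B, T \subset TB B &
   [forall x in (SB bases B :|: TB B) :\: (S :|: T), forall y in S :|: T, x < y]].

(** * Labels of a fixed nbc basis under max-first insertion *)

Section NbcBasis.
Variable B : {set E}.
Hypotheses (bB : B \in bases) (nbcB : EA bases B = set0).

Lemma SB_sub : SB bases B \subset B. Proof. exact: subsetDl. Qed.

Lemma TB_min : exists m, [/\ m \notin B, forall x, x \notin B -> m <= x & TB B = ~: B :\ m].
Proof.
(* The default branch of [TB] does not occur: the complement of [B] is nonempty because $r<n$. *)
rewrite /TB; case: pickP => [m|noMin].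
  rewrite inE is_minE => /andP[mB /andP[_ /forall_inP mm]].
  by exists m; split=> // x xB; apply: mm; rewrite inE.
have [z zB] : exists z, z \in ~: B.
  apply/set0Pn; rewrite -card_gt0 card_setCS (bases_card bB).
  by have := ltn_rank_ground; lia.
case: (arg_minnP (@nat_of_ord _) zB) => m mB mm.
have := noMin m; rewrite is_minE; have -> : m \in ~: B by [].
by move/negbT/forall_inPn => [x xB]; rewrite mm.
Qed.

Lemma TB_sub : TB B \subset ~: B.
Proof. by have [m [_ _ ->]] := TB_min; apply: subD1set. Qed.

Lemma card_TB : #|TB B| = n - r - 1.
Proof.
have [m [mB _ ->]] := TB_min; have := cardsD1 m (~: B).
have -> : m \in ~: B by rewrite inE.
by rewrite card_setCS (bases_card bB) add1n subSS => ->; rewrite subn1.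
Qed.

Lemma card_SB k : k <= r -> #|IA bases B| = k.+1 -> #|SB bases B| = r - k.
Proof.
move=> kr cI; rewrite cardsD (bases_card bB) (setIidPr _) ?cI //.
by apply/subsetP => x; rewrite (mem_IA _ bB) => /andP[].
Qed.

(** An element of [SB] is not internally active, so it is exchangeable with a smaller element
    outside [B], and that one is at least [m]. *)
Lemma SB_TB_above m : m \notin B -> (forall x, x \notin B -> m <= x) -> TB B = ~: B :\ m ->
  forall e, e \in SB bases B :|: TB B -> m < e.
Proof.
move=> mB mm eT e; rewrite in_setU eT in_setD (mem_IA _ bB) => /orP[/andP[nI eB]|].
  rewrite eB /= in nI; case/forall_inPn: nI => y yB; rewrite negb_imply -leqNgt => /andP[_ ye].
  rewrite inE in yB; have := mm _ yB; rewrite ltn_neqAle => my.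
  rewrite (leq_trans my ye) andbT; apply: contraNneq mB => /val_inj -> //.
rewrite !inE => /andP[em eB]; rewrite ltn_neqAle mm // andbT.
by apply: contraNneq em => /val_inj ->.
Qed.

(** As [m] is not externally active, it is exchangeable with some [b] below it. This [b] is smaller
    than everything outside [B], hence internally active and missing from [SB]; so [SB] does not
    span [m]. *)
Lemma TB_min_gap m : m \notin B -> (forall x, x \notin B -> m <= x) -> TB B = ~: B :\ m ->
  m \in gap (SB bases B) (TB B).
Proof.
move=> mB mm eT; apply/gapP; split; last first.
   rewrite eT; apply: (indep_notin_cl dual_bases_matroid).
    by rewrite !inE eqxx.
  by rewrite setD1K ?inE //; apply: base_indep; rewrite mem_dual_bases setCK.
rewrite (mem_cl_B bB SB_sub mB).
have : m \notin EA bases B by rewrite nbcB inE.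
rewrite (mem_EA _ bB) mB /= => /forall_inPn[b bBB]; rewrite negb_imply -leqNgt => /andP[bb bm].
apply/forall_inPn; exists b; rewrite // bb implyTb in_setD negb_and negbK bBB orbF.
rewrite (mem_IA _ bB) bBB; apply/forall_inP => e; rewrite inE => eB; apply/implyP => _.
apply: leq_trans (mm _ eB); rewrite ltn_neqAle bm andbT.
by apply: contraNneq mB => /val_inj <-.
Qed.

(** On its own side [e] avoids the closure by independence. On the other side inactivity gives an
    exchange partner smaller than [e], which the set of larger labels cannot contain. *)
Lemma SB_TB_gap e : e \in SB bases B :|: TB B ->
  e \in gap (above e (SB bases B)) (above e (TB B)).
Proof.
have sS : above e (SB bases B) \subset B by apply: subset_trans SB_sub; apply: above_sub.
have sT : above e (TB B) \subset ~: B by apply: subset_trans TB_sub; apply: above_sub.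
rewrite inE => /orP[eS|eT]; apply/gapP; split.
- have eB := subsetP SB_sub _ eS.
  apply: (indep_notin_cl bases_matroid); first by rewrite inE ltnn andbF.
  by apply: indepS (base_indep bB); rewrite subUset sub1set eB.
- have eB := subsetP SB_sub _ eS.
  rewrite (mem_clp_B bB sT eB); move: eS; rewrite in_setD (mem_IA _ bB) eB /= andbT.
  case/forall_inPn => d dB; rewrite negb_imply => /andP[dd le].
  by apply/forall_inPn; exists d => //; rewrite dd /= inE (negPf le) andbF.
- have := subsetP TB_sub _ eT; rewrite inE => eB.
  rewrite (mem_cl_B bB sS eB).
  have : e \notin EA bases B by rewrite nbcB inE.
  rewrite (mem_EA _ bB) eB /= => /forall_inPn[b bBB]; rewrite negb_imply => /andP[bb le].
  by apply/forall_inPn; exists b => //; rewrite bb /= inE (negPf le) andbF.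
- apply: (indep_notin_cl dual_bases_matroid); first by rewrite inE ltnn andbF.
  apply: (@indepS _ _ _ (~: B)); first by rewrite subUset sub1set (subsetP TB_sub).
  by apply: base_indep; rewrite mem_dual_bases setCK.
Qed.

(** An element [f] of the gap above [e] is neither a label nor [m], so it is an internally active
    element of [B]. All its exchange partners then exceed [f], hence lie in [T], and [f] would be in
    [clp T]. *)
Lemma gap_le m e f S T : m \notin B -> (forall x, x \notin B -> m <= x) -> TB B = ~: B :\ m ->
  m <= e -> above e (SB bases B) \subset S -> above e (TB B) \subset T -> T \subset TB B ->
  f \in gap S T -> f <= e.
Proof.
move=> mB mm eT me sS sT sTB fg; rewrite leqNgt; apply/negP => ef.
have := gap_notin fg; rewrite inE negb_or => /andP[fS fT].
have {}fT : f \notin TB B by apply: contraNN fT => fT; apply: (subsetP sT); rewrite inE fT.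
have {}fS : f \notin SB bases B by apply: contraNN fS => fS; apply: (subsetP sS); rewrite inE fS.
have fm : f != m by apply: contraTneq ef => ->; rewrite -leqNgt.
have fB : f \in B by move: fT; rewrite eT !inE fm negbK.
case/gapP: fg => _; rewrite (mem_clp_B bB (subset_trans sTB TB_sub) fB) => /forall_inPn[d dB].
rewrite negb_imply => /andP[dd dT].
have : f \in IA bases B by move: fS; rewrite in_setD fB andbT negbK.
rewrite (mem_IA _ bB) => /andP[_ /forall_inP/(_ _ dB)/implyP/(_ dd)] fd.
case/negP: dT; apply: (subsetP sT); rewrite inE (ltn_trans ef fd) andbT eT 2!inE dB andbT.
by apply: contraTneq (ltn_trans ef fd) => ->; rewrite -leqNgt.
Qed.

Lemma compatible_gap S T : compatible_split B S T -> gap S T != set0.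
Proof.
case/and3P=> sS sT _; have [m [mB mm eT]] := TB_min.
apply/set0Pn; exists m; apply: (subsetP (gapS sS sT)); exact: TB_min_gap.
Qed.

Lemma compatible_full S T : compatible_split B S T -> #|SB bases B| + #|TB B| <= #|S| + #|T| ->
  S = SB bases B /\ T = TB B.
Proof.
case/and3P=> sS sT _ le.
split; apply/eqP; rewrite eqEcard ?sS ?sT /=.
  by rewrite -(leq_add2r #|T|) (leq_trans _ le) // leq_add2l subset_leq_card.
by rewrite -(leq_add2l #|S|) (leq_trans _ le) // leq_add2r subset_leq_card.
Qed.

Lemma SB_TB_disjoint : [disjoint SB bases B & TB B].
Proof.
rewrite -setI_eq0 -subset0; apply/subsetP => x; rewrite inE => /andP[xS xT].
by have := subsetP TB_sub _ xT; rewrite inE (subsetP SB_sub _ xS).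
Qed.

(** By [SB_TB_gap] and [gap_le] the largest element of the gap is the largest label of [B] not yet
    collected. It belongs to exactly one of [SB] and [TB], which is what splits the sum over bases
    in two. *)
Lemma compatible_next S T e : compatible_split B S T ->
  #|S| + #|T| < #|SB bases B| + #|TB B| ->
  e \in gap S T -> (forall f, f \in gap S T -> f <= e) ->
  compatible_split B (e |: S) T (+) compatible_split B S (e |: T).
Proof.
case/and3P=> sS sT /forall_inP cST lt eg emax.
have [z zU] : exists z, z \in (SB bases B :|: TB B) :\: (S :|: T).
  apply/set0Pn; rewrite setD_eq0; apply: contraTN lt => /subset_leq_card.
  by rewrite !cardsU (disjoint_setI0 SB_TB_disjoint) cards0 -leqNgt; lia.
case: (arg_maxnP (@nat_of_ord _) zU) => w wU wmax {z zU}.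
have [m [mB mm eT]] := TB_min.
have /andP[wNST wST] : (w \notin S :|: T) && (w \in SB bases B :|: TB B) by rewrite -in_setD.
have aS : above w (SB bases B) = S.
  apply/setP => y; rewrite inE; apply/andP/idP => [[yS wy]|yS].
    apply: contraTT wy => yNS; rewrite -leqNgt; apply: wmax.
    change (y \in (SB bases B :|: TB B) :\: (S :|: T)); rewrite in_setD !in_setU yS andbT negb_or yNS /=.
    by apply/negP => /(subsetP sT); rewrite (disjointFr SB_TB_disjoint yS).
  by rewrite (subsetP sS) // (forall_inP (cST _ wU)) // inE yS.
have aT : above w (TB B) = T.
  apply/setP => y; rewrite inE; apply/andP/idP => [[yS wy]|yS].
    apply: contraTT wy => yNS; rewrite -leqNgt; apply: wmax.
    change (y \in (SB bases B :|: TB B) :\: (S :|: T)); rewrite in_setD !in_setU yS orbT andbT negb_or yNS andbT.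
    by apply/negP => /(subsetP sS); rewrite (disjointFl SB_TB_disjoint yS).
  by rewrite (subsetP sT) // (forall_inP (cST _ wU)) // inE yS orbT.
have wg : w \in gap S T by rewrite -{1}aS -{1}aT SB_TB_gap.
have ew : e = w.
  apply/val_inj/eqP; rewrite eqn_leq (emax _ wg) andbT.
  apply: (gap_le mB mm eT (ltnW (SB_TB_above mB mm eT wST))) eg => //; first by rewrite aS.
  by rewrite aT.
rewrite {e eg emax}ew.
have wmin y : y \in S :|: T -> w < y by move=> yST; apply: (forall_inP (cST _ wU)).
have rest S' T' : S' :|: T' = w |: (S :|: T) ->
  [forall x in (SB bases B :|: TB B) :\: (S' :|: T'), forall y in S' :|: T', x < y].
  move=> ->; apply/forall_inP => x; rewrite in_setD in_setU1 negb_or => /andP[/andP[xw xNST] xST].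
  have xU : x \in (SB bases B :|: TB B) :\: (S :|: T) by rewrite in_setD xNST.
  apply/forall_inP => y; rewrite in_setU1 => /orP[/eqP->|yST].
    rewrite ltn_neqAle (wmax x xU : x <= w) andbT; apply: contraNneq xw => /val_inj ->; exact: eqxx.
  exact: (forall_inP (cST _ xU)).
have rS : (w |: S) :|: T = w |: (S :|: T) by rewrite setUA.
have rT : S :|: (w |: T) = w |: (S :|: T) by rewrite setUCA.
rewrite /compatible_split !subUset !sub1set sS sT (rest _ _ rS) (rest _ _ rT).
rewrite !andbT; move: wST; rewrite inE => /orP[wS|wT].
  by rewrite wS (disjointFr SB_TB_disjoint wS).
by rewrite wT (disjointFl SB_TB_disjoint wT).
Qed.

Lemma compatible_prev_l S T e : (forall y, y \in S :|: T -> e < y) ->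
  compatible_split B (e |: S) T -> compatible_split B S T.
Proof.
move=> lt /and3P[]; rewrite subUset sub1set => /andP[eS sS] sT /forall_inP cST.
apply/and3P; split=> //; apply/forall_inP => x; rewrite inE => /andP[xST xB].
apply/forall_inP => y yST; case: (eqVneq x e) => [->|xe]; first exact: lt.
apply: (forall_inP (cST x _)); first by rewrite inE xB andbT -setUA in_setU1 negb_or xe.
by rewrite -setUA in_setU1 yST orbT.
Qed.

Lemma compatible_prev_r S T e : (forall y, y \in S :|: T -> e < y) ->
  compatible_split B S (e |: T) -> compatible_split B S T.
Proof.
move=> lt /and3P[] sS; rewrite subUset sub1set => /andP[eT sT] /forall_inP cST.
apply/and3P; split=> //; apply/forall_inP => x; rewrite inE => /andP[xST xB].
apply/forall_inP => y yST; case: (eqVneq x e) => [->|xe]; first exact: lt.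
apply: (forall_inP (cST x _)); first by rewrite inE xB andbT setUCA in_setU1 negb_or xe.
by rewrite setUCA in_setU1 yST orbT.
Qed.

(** The largest element of the final gap is the minimum of $E-B$, the one element that [TB] omits;
    so a basis is recovered from its label sets. *)
Lemma nbc_determined m : (forall f, f \in gap (SB bases B) (TB B) -> f <= m) ->
  m \in gap (SB bases B) (TB B) -> B = ~: (m |: TB B).
Proof.
move=> mmax mg; have [m' [mB mm eT]] := TB_min.
have -> : m = m'.
  apply/val_inj/eqP; rewrite eqn_leq mmax ?TB_min_gap // andbT.
  by apply: (gap_le mB mm eT (leqnn _) _ _ _ mg); rewrite // above_sub.
by rewrite eT setD1K ?inE // setCK.
Qed.

End NbcBasis.

(* Labels decrease, so [above e S] and [above e T] are the label sets just before [e] is chosen. *)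
Definition greedy_split S T : Prop :=
  forall e, e \in S :|: T -> e \in gap (above e S) (above e T) /\
    forall f, f \in gap (above e S) (above e T) -> f <= e.

Lemma above_setU1 e x A : (forall y, y \in A -> e < y) ->
  above x (e |: A) = if x < e then e |: A else above x A.
Proof.
move=> lt; apply/setP => y; case: ifP => xe; rewrite !inE.
  by case: (eqVneq y e) => [->|] //= _; apply: andb_idr => /lt; exact: ltn_trans.
by case: (eqVneq y e) => [->|] //=; rewrite xe andbF.
Qed.

Lemma above_all e A : (forall y, y \in A -> e < y) -> above e A = A.
Proof. by move=> lt; apply/setP => y; rewrite inE; apply: andb_idr => /lt. Qed.

Lemma greedy_lt S T e : greedy_split S T -> e \in gap S T -> forall y, y \in S :|: T -> e < y.
Proof.
move=> gST eg y yST; rewrite ltn_neqAle (gST _ yST).2.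
  by rewrite andbT; apply: contraTneq yST => /val_inj <-; apply: gap_notin.
by apply: (subsetP (gapS _ _)) eg; apply: above_sub.
Qed.

Lemma greedy_next S S' T T' e : greedy_split S T -> e \in gap S T ->
  (forall f, f \in gap S T -> f <= e) -> S' :|: T' = e |: (S :|: T) ->
  S' = S \/ S' = e |: S -> T' = T \/ T' = e |: T -> greedy_split S' T'.
Proof.
move=> gST eg emax eU hS hT x; have lt := greedy_lt gST eg.
have ltS y : y \in S -> e < y by move=> yS; apply: lt; rewrite inE yS.
have ltT y : y \in T -> e < y by move=> yS; apply: lt; rewrite inE yS orbT.
rewrite eU in_setU1 => /orP[/eqP->|xST].
  have -> : above e S' = S.
    by case: hS => ->; rewrite ?above_setU1 ?ltnn // above_all.
  have -> : above e T' = T.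
    by case: hT => ->; rewrite ?above_setU1 ?ltnn // above_all.
  by split.
have xe : (x < e) = false by apply/negbTE; rewrite -leqNgt ltnW ?lt.
have -> : above x S' = above x S by case: hS => -> //; rewrite above_setU1 ?xe.
have -> : above x T' = above x T by case: hT => -> //; rewrite above_setU1 ?xe.
exact: gST.
Qed.

(** Suppose [e] outside [B] is exchangeable with a larger [b] in [B] but not in [S]. Then [b] lies
    in the gap from which [e] was chosen, against the maximality of [e]. This makes all of [B :\: S]
    internally active and rules out external activity. An element of [S] is inactive because it
    avoided the closure of the larger labels in [T], which yields a smaller exchange partner. *)
Lemma nbc_of_greedy S T m : greedy_split S T -> [disjoint S & T] -> indep S -> indepp T ->
  #|T| = n - r - 1 -> m \in gap S T -> (forall f, f \in gap S T -> f <= m) ->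
  let B := ~: (m |: T) in [/\ nbc_basis bases B, SB bases B = S & TB B = T].
Proof.
move=> gST dST iS iT cT mg mmax B.
have [mS mT] := gapP _ _ _ mg.
have mNST := gap_notin mg.
have lt := greedy_lt gST mg.
have mltS y : y \in S -> m < y by move=> yS; apply: lt; rewrite inE yS.
have mltT y : y \in T -> m < y by move=> yS; apply: lt; rewrite inE yS orbT.
have BC : ~: B = m |: T by rewrite setCK.
clearbody B.
have inBC x : (x \notin B) = (x \in m |: T) by rewrite -BC in_setC.
have bB : B \in bases.
  rewrite -[B]setCK -mem_dual_bases BC.
  have /indepP[B' bB' sB'] := indep_setU1 dual_bases_matroid dual_bases_card iT mT.
  have -> // : m |: T = B'.
  apply/eqP; rewrite eqEcard sB' (dual_bases_card bB') cardsU1 cT.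
  have := ltn_rank_ground; move: mNST; rewrite inE negb_or => /andP[_ ->]; rewrite add1n; lia.
have sSB : S \subset B.
  apply/subsetP => x xS; rewrite -[x \in B]negbK inBC in_setU1 negb_or (disjointFr dST xS) andbT.
  by apply: contraNneq mNST => <-; rewrite inE xS.
have sTB : T \subset ~: B by rewrite BC subsetUr.
have gr e : e \in m |: (S :|: T) -> e \in gap (above e S) (above e T) /\
    forall f, f \in gap (above e S) (above e T) -> f <= e.
  rewrite in_setU1 => /orP[/eqP->|]; last exact: gST.
  by rewrite !above_all.
have grB e : e \notin B -> e \in gap (above e S) (above e T) /\
    forall f, f \in gap (above e S) (above e T) -> f <= e.
  by rewrite inBC => eT; apply: gr; rewrite setUCA inE eT orbT.
have aS e : above e S \subset B by apply: subset_trans sSB; apply: above_sub.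
have aT e : above e T \subset ~: B by apply: subset_trans sTB; apply: above_sub.
have BnS w : w \in B -> w \notin S -> forall e, w \notin cl (above e S).
  move=> wB wS e; apply: contraNN (subsetP (clS bases_matroid bases_card (above_sub e S)) w) _.
  apply: (indep_notin_cl bases_matroid wS).
  by apply: indepS (base_indep bB); rewrite subUset sub1set wB.
have eIA : IA bases B = B :\: S.
  apply/setP => w; rewrite (mem_IA _ bB) in_setD; case: (boolP (w \in B)) => wB; rewrite ?andbF // andbT andTb.
  case: (boolP (w \in S)) => wS /=.
    have wST : w \in S :|: T by rewrite inE wS.
    have [/gapP[_ wT] _] := gST w wST; move: wT.
    rewrite (mem_clp_B bB (aT _) wB) => /forall_inPn[e eB]; rewrite negb_imply => /andP[ee eN].
    apply/negbTE/forall_inPn; exists e => //; rewrite ee /= -leqNgt.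
    move: eB; rewrite BC in_setU1 => /orP[/eqP->|eT]; first by rewrite ltnW ?mltS.
    by move: eN; rewrite inE eT /= -leqNgt.
  apply/forall_inP => e; rewrite inE => eB; apply/implyP => ee.
  rewrite ltnNge; apply/negP => le.
  have lew : e < w by rewrite ltn_neqAle le andbT; apply: contraNneq eB => /val_inj ->.
  have [_ emax] := grB _ eB.
  have /negP := BnS _ wB wS e; apply.
  apply: contraTT lew => wN; rewrite -leqNgt; apply: emax; apply/gapP; split=> //.
  rewrite (mem_clp_B bB (aT _) wB); apply/forall_inPn; exists e; rewrite ?inE //.
  by rewrite ee /= ltnn andbF.
have eTB : TB B = T.
  have [m' [m'B mm eT]] := TB_min bB.
  have em : m' = m.
    move: m'B; rewrite inBC in_setU1 => /orP[/eqP//|m'T].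
    have := mm m; rewrite inBC setU11 leqNgt mltT // => /(_ isT) //.
  by rewrite eT em BC setU1K // ; move: mNST; rewrite inE negb_or => /andP[].
split=> //; last by rewrite /SB eIA setDDr setDv set0U (setIidPr sSB).
rewrite /nbc_basis bB -subset0; apply/subsetP => x; rewrite (mem_EA _ bB) => /andP[xB /forall_inP xE].
have [/gapP[+ _] xmax] := grB _ xB.
rewrite (mem_cl_B bB (aS _) xB) => /forall_inPn[b bBB]; rewrite negb_imply => /andP[bb bN].
have xb := implyP (xE _ bBB) bb.
have bS : b \notin S by apply: contraNN bN => bS; rewrite inE bS.
suff : b <= x by rewrite leqNgt xb.
apply: xmax; apply/gapP; split; first exact: BnS.
rewrite (mem_clp_B bB (aT _) bBB); apply/forall_inPn; exists x; rewrite ?inE //.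
by rewrite bb /= ltnn andbF.
Qed.

End Activity.

(** * The conormal Chow ring *)

Section ChowRing.
Variables (n : nat) (bases : {set {set 'I_n.+1}}) (R : comNzRingType).
Local Notation E := 'I_n.+1.
Local Notation xvar := (xvar bases R).
Local Notation xmon := (xmon bases R).
Local Notation gam := (gam bases R).
Local Notation gambar := (gambar bases R).
Local Notation del := (del bases R).
Local Notation biflat := (is_biflat bases).
Local Notation biflag := (is_biflag bases).
Local Notation "f === g" := (chow_eq f g) (at level 70).
Implicit Types (f g h : Spoly bases R) (p q : {set E} * {set E}) (X : {set {set E} * {set E}}).
Local Open Scope ring_scope.

Definition vanishes f : Prop := in_ideal (fun h => Igen h \/ Jgen h) f.

Lemma vanishes0 : vanishes 0.
Proof. by exists [::]; rewrite big_nil; split. Qed.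

Lemma vanishesD f g : vanishes f -> vanishes g -> vanishes (f + g).
Proof.
move=> [s [hs ->]] [t [ht ->]]; exists (s ++ t); rewrite big_cat; split=> // c.
by rewrite mem_cat => /orP[/hs|/ht].
Qed.

Lemma vanishesM h f : vanishes f -> vanishes (h * f).
Proof.
move=> [s [hs ->]]; exists [seq (h * c.1, c.2) | c <- s]; split=> [c|].
  by move=> /mapP[d /hs hd ->].
by rewrite big_map mulr_sumr; apply: eq_bigr => c _; rewrite mulrA.
Qed.

Lemma vanishesN f : vanishes f -> vanishes (- f).
Proof. by move/(vanishesM (-1)); rewrite mulN1r. Qed.

Lemma vanishes_sum (I : finType) (P : pred I) (F : I -> Spoly bases R) :
  (forall i, P i -> vanishes (F i)) -> vanishes (\sum_(i | P i) F i).
Proof. by move=> vF; elim/big_ind: _ => //; [exact: vanishes0 | exact: vanishesD]. Qed.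

Lemma vanishes_Jgen f : Jgen f -> vanishes f.
Proof.
move=> Jf; exists [:: (1, f)]; rewrite big_seq1 mul1r; split=> // c.
by rewrite inE => /eqP->; right.
Qed.

Lemma chow_refl f : f === f.
Proof. by rewrite /chow_eq subrr; apply: vanishes0. Qed.

Lemma chow_sym f g : f === g -> g === f.
Proof. by move/vanishesN; rewrite opprB. Qed.

Lemma chow_trans g f h : f === g -> g === h -> f === h.
Proof. by move=> fg /(vanishesD fg); rewrite addrA subrK. Qed.

Lemma chowD f f' g g' : f === f' -> g === g' -> f + g === f' + g'.
Proof. by move=> ff /(vanishesD ff); rewrite /chow_eq opprD addrACA. Qed.

Lemma chowMl h f g : f === g -> h * f === h * g.
Proof. by move/(vanishesM h); rewrite mulrBr. Qed.

Lemma chowMr h f g : f === g -> f * h === g * h.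
Proof. by rewrite ![_ * h]mulrC; apply: chowMl. Qed.

Lemma chow_vanishes f g : f === g -> vanishes g -> vanishes f.
Proof. by move=> fg /(vanishesD fg); rewrite subrK. Qed.

Lemma vanishes_chow0 f : vanishes f -> f === 0.
Proof. by rewrite /chow_eq subr0. Qed.

Lemma gam_indep i j : gam i === gam j.
Proof. by apply: vanishes_Jgen; exists i, j; left. Qed.

Lemma gambar_indep i j : gambar i === gambar j.
Proof. by apply: vanishes_Jgen; exists i, j; right. Qed.

(* Since [F :|: G] is the ground set, each biflat contributes the same amount to
   [del i + (sum of all variables)] and to [gam i + gambar i + (terms with F or G full)]. *)
Lemma delE i : del i = gam i + gambar i + (\sum_(p | biflat p && (p.1 == setT)) xvar p
  + \sum_(p | biflat p && (p.2 == setT)) xvar p) - \sum_(p | biflat p) xvar p.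
Proof.
apply/eqP; rewrite eq_sym subr_eq eq_sym; apply/eqP.
pose t (b : bool) p : Spoly bases R := if b then xvar p else 0.
have st (P : pred ({set E} * {set E})) (b : {set E} * {set E} -> bool) :
    P =1 (fun p => biflat p && b p) -> \sum_(p | P p) xvar p = \sum_(p | biflat p) t (b p) p.
  by move=> eP; rewrite (eq_bigl _ _ eP) big_mkcondr.
have -> : del i = \sum_(p | biflat p) t (i \in p.1 :&: p.2) p by apply: st.
have -> : gam i = \sum_(p | biflat p) t ((i \in p.1) && (p.1 != setT)) p.
  by apply: st => p; rewrite andbA.
have -> : gambar i = \sum_(p | biflat p) t ((i \in p.2) && (p.2 != setT)) p.
  by apply: st => p; rewrite andbA.
rewrite (st (fun p => biflat p && (p.1 == setT)) (fun p => p.1 == setT)) //.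
rewrite (st (fun p => biflat p && (p.2 == setT)) (fun p => p.2 == setT)) // -!big_split /=.
apply: eq_bigr => p /and5P[_ _ _ _ /andP[_ /eqP/setP/(_ i)]]; rewrite !inE /t.
case: (eqVneq p.1 setT) => [->|_]; case: (eqVneq p.2 setT) => [->|_]; rewrite ?inE /=;
case: (i \in p.1); case: (i \in p.2) => //= _; rewrite ?addr0 ?add0r //.
Qed.

Lemma del_indep i j : del i === del j.
Proof.
rewrite !delE; apply: chowD; last exact: chow_refl.
apply: chowD; last exact: chow_refl.
by apply: chowD; [apply: gam_indep | apply: gambar_indep].
Qed.

Lemma xvar_notbiflat p : ~~ biflat p -> xvar p = 0.
Proof. by move=> np; rewrite /Defs.xvar insubN. Qed.

Lemma xmonU1 p X : p \notin X -> xmon (p |: X) = xvar p * xmon X.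
Proof. by move=> pX; rewrite /Defs.xmon big_setU1. Qed.

(** [xmon] is squarefree; a repeated variable goes into the cofactor, so that vanishing can always
    be tested on a set of biflats. *)
Lemma xvarM_xmon p X : exists h, xvar p * xmon X = h * xmon (p |: X).
Proof.
case: (boolP (p \in X)) => pX; last by exists 1; rewrite mul1r xmonU1.
by exists (xvar p); rewrite (setUidPr _) // sub1set.
Qed.

(** [Igen] speaks only of sets of biflats; any other set has zero monomial through the default value
    of [xvar]. *)
Lemma xmon_notbiflag X : ~~ biflag X -> vanishes (xmon X).
Proof.
move=> nX; case: (boolP [forall p in X, biflat p]) => [/forall_inP bX|/forall_inPn[p pX np]].
  exists [:: (1, xmon X)]; rewrite big_seq1 mul1r; split=> // c.
  by rewrite inE => /eqP->; left; exists X.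
rewrite /Defs.xmon (bigD1 p) //= xvar_notbiflat // mul0r; exact: vanishes0.
Qed.

Lemma xmon_biflag h X : (biflag X -> vanishes (h * xmon X)) -> vanishes (h * xmon X).
Proof. by case: (boolP (biflag X)) => [_ v|/xmon_notbiflag/(vanishesM h)//]; apply: v. Qed.

(** Only the expanded factor changes its index to [c], so every expansion can use a fresh index. *)
Lemma gam_expand i c k X : gam i ^+ k.+1 * xmon X ===
  \sum_(p | biflat p && (c \in p.1) && (p.1 != setT)) gam i ^+ k * (xvar p * xmon X).
Proof.
rewrite -mulr_sumr -mulr_suml exprSr -mulrA; apply/chowMl/chowMr; exact: gam_indep.
Qed.

Definition uncovered X : {set E} := ~: \bigcup_(p in X) (p.1 :&: p.2).

Lemma uncoveredP e X : reflect (forall p, p \in X -> e \in p.1 -> e \in p.2 -> False)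
  (e \in uncovered X).
Proof.
rewrite inE; apply: (iffP idP) => [eN p pX e1 e2|eN].
  by case/negP: eN; apply/bigcupP; exists p; rewrite // inE e1.
by apply/bigcupP => -[p pX]; rewrite inE => /andP[]; apply: eN.
Qed.

(** Since [e] is uncovered, no biflat of the sum is already in [X], and all products stay
    squarefree. *)
Lemma del_expand h j e N X : e \in uncovered X -> h * del j ^+ N.+1 * xmon X ===
  \sum_(p | biflat p && (e \in p.1 :&: p.2)) h * del j ^+ N * xmon (p |: X).
Proof.
move=> eX; rewrite (eq_bigr (fun p => h * del j ^+ N * (xvar p * xmon X))).
  rewrite -mulr_sumr -mulr_suml exprSr mulrA -[_ * del j * _]mulrA.
  apply/chowMl/chowMr; exact: del_indep.
move=> p /andP[_]; rewrite inE => /andP[e1 e2]; rewrite xmonU1 //.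
by apply/negP => pX; move/uncoveredP: eX => /(_ p pX e1 e2).
Qed.

Lemma del_step h j e N X : e \in uncovered X ->
  (forall p, biflat p -> e \in p.1 -> e \in p.2 -> biflag (p |: X) ->
     vanishes (h * del j ^+ N * xmon (p |: X))) ->
  vanishes (h * del j ^+ N.+1 * xmon X).
Proof.
move=> eX vp; apply: chow_vanishes (del_expand h j N eX) _.
apply: vanishes_sum => p /andP[bp]; rewrite inE => /andP[e1 e2].
by apply: xmon_biflag => bX; apply: vp.
Qed.

Lemma gam_step i c k X :
  (forall p, biflat p -> c \in p.1 -> p.1 != setT -> biflag (p |: X) ->
     vanishes (gam i ^+ k * xmon (p |: X))) ->
  vanishes (gam i ^+ k.+1 * xmon X).
Proof.
move=> vp; apply: chow_vanishes (gam_expand i c k X) _.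
apply: vanishes_sum => p /andP[/andP[bp e1] e2].
have [h ->] := xvarM_xmon p X; rewrite mulrCA; apply: vanishesM.
by apply: xmon_biflag => bX; apply: vp.
Qed.

End ChowRing.

(** * Biflags as chains, and their labels *)

Section Biflags.
Variables (n r : nat) (bases : {set {set 'I_n.+1}}) (R : comNzRingType).
Local Notation E := 'I_n.+1.
Hypothesis bases_matroid : is_matroid_bases bases.
Hypothesis bases_card : forall B, B \in bases -> #|B| = r.+1.
Hypothesis loopless : forall x : E, exists2 B, B \in bases & x \in B.
Hypothesis coloopless : forall x : E, exists2 B, B \in bases & x \notin B.
Local Notation rk := (mrank bases).
Local Notation indepp := (Defs.indep (dual_bases bases)).
Local Notation flat := (is_flat bases).
Local Notation flatp := (is_flat (dual_bases bases)).
Local Notation xmon := (xmon bases R).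
Local Notation gam := (gam bases R).
Local Notation biflat := (is_biflat bases).
Local Notation biflag := (is_biflag bases).
Implicit Types (p q : {set E} * {set E}) (X Y : {set {set E} * {set E}}) (S T : {set E}) (i j e : E).

Let bases'_matroid := dual_bases_matroid bases_matroid bases_card.
Let bases'_card := dual_bases_card bases_card.

Lemma biflag_biflat X p : biflag X -> p \in X -> biflat p.
Proof. by case/andP=> /andP[/forall_inP h _] _; apply: h. Qed.

Lemma biflag_compatible X p q : biflag X -> p \in X -> q \in X -> compatible p q.
Proof. by case/andP=> /andP[_ /forall_inP h] _ /h /forall_inP; apply. Qed.

Lemma biflag_uncovered X : biflag X -> uncovered X != set0.
Proof. by case/andP=> _; apply: contraNneq => e; rewrite -[X in X == _]setCK -/(uncovered X) e setC0. Qed.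

Lemma biflat_flat p : biflat p -> flat p.1.
Proof. by case/and5P. Qed.

Lemma biflat_flatp p : biflat p -> flatp p.2.
Proof. by case/and5P. Qed.

Lemma biflat_cover p e : biflat p -> e \notin p.2 -> e \in p.1.
Proof. by case/and5P=> _ _ _ _ /andP[_ /eqP/setP/(_ e)]; rewrite !inE => /orP[//|->]. Qed.

Lemma flat0 : flat set0.
Proof. by apply/eqP/cl0. Qed.

Lemma flatp0 : flatp set0.
Proof.
apply/eqP/cl0 => // x; have [B bB xB] := coloopless x.
by exists (~: B); rewrite ?mem_dual_bases ?setCK // inE.
Qed.

Lemma chain_max X Y q : biflag X -> Y \subset X -> q \in Y ->
  exists2 p, p \in Y & forall q, q \in Y -> (q.1 \subset p.1) && (p.2 \subset q.2).
Proof.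
move=> bX sYX qY.
(* This size is monotone along the chain, and comparable biflats of equal size are equal. *)
case: (arg_maxnP (fun p => #|p.1| + #|~: p.2|) qY) => p pY pmax.
exists p => // q' q'Y.
have /orP[/andP[s1 s2]|] := biflag_compatible bX (subsetP sYX _ pY) (subsetP sYX _ q'Y); last by [].
have := pmax _ q'Y; rewrite /geq /= => le.
have l1 := subset_leq_card s1.
have l2 : #|~: p.2| <= #|~: q'.2| by rewrite subset_leq_card // setCS.
have e1 : p.1 = q'.1.
  by apply/eqP; rewrite eqEcard s1 -(leq_add2r #|~: p.2|) (leq_trans _ le) // leq_add2l.
have e2 : ~: p.2 = ~: q'.2.
  by apply/eqP; rewrite eqEcard setCS s2 -(leq_add2l #|p.1|) (leq_trans _ le) // leq_add2r.
by move/setC_inj: e2 => ->; rewrite e1 !subxx.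
Qed.

Lemma chain_min X Y q : biflag X -> Y \subset X -> q \in Y ->
  exists2 p, p \in Y & forall q, q \in Y -> (p.1 \subset q.1) && (q.2 \subset p.2).
Proof.
move=> bX sYX qY.
case: (arg_minnP (fun p => #|p.1| + #|~: p.2|) qY) => p pY pmin.
exists p => // q' q'Y.
have /orP[|/andP[s1 s2]] := biflag_compatible bX (subsetP sYX _ pY) (subsetP sYX _ q'Y); first by [].
have := pmin _ q'Y; move=> le.
have l1 := subset_leq_card s1.
have l2 : #|~: q'.2| <= #|~: p.2| by rewrite subset_leq_card // setCS.
have e1 : q'.1 = p.1.
  by apply/eqP; rewrite eqEcard s1 -(leq_add2r #|~: q'.2|) (leq_trans _ le) // leq_add2l.
have e2 : ~: q'.2 = ~: p.2.
  by apply/eqP; rewrite eqEcard setCS s2 -(leq_add2l #|q'.1|) (leq_trans _ le) // leq_add2r.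
by move/setC_inj: e2 => ->; rewrite e1 !subxx.
Qed.

(** For a biflag the two unions are the largest proper $F$ and the largest $G$ paired with $F=E$, or
    empty if there is none. A biflat with both parts proper counts on the left. *)
Definition left_flat X : {set E} := \bigcup_(p in X | p.1 != setT) p.1.
Definition right_flat X : {set E} := \bigcup_(p in X | p.1 == setT) p.2.

Lemma left_flat_sup X p : p \in X -> p.1 != setT -> p.1 \subset left_flat X.
Proof. by move=> pX p1; apply: (bigcup_sup p); rewrite pX. Qed.

Lemma right_flat_sup X p : p \in X -> p.1 = setT -> p.2 \subset right_flat X.
Proof. by move=> pX p1; apply: (bigcup_sup p); rewrite pX p1 eqxx. Qed.

Lemma left_flatS X Y : X \subset Y -> left_flat X \subset left_flat Y.
Proof. by move=> sXY; apply/bigcupsP => p /andP[pX p1]; rewrite left_flat_sup ?(subsetP sXY). Qed.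

Lemma right_flatS X Y : X \subset Y -> right_flat X \subset right_flat Y.
Proof. by move=> sXY; apply/bigcupsP => p /andP[pX /eqP p1]; rewrite right_flat_sup ?(subsetP sXY). Qed.

Lemma left_flatP X : biflag X -> left_flat X = set0 \/
  exists p, [/\ p \in X, p.1 != setT & left_flat X = p.1].
Proof.
move=> bX; case: (set_0Vmem [set p in X | p.1 != setT]) => [e0|[q qY]].
  left; apply/eqP; rewrite -subset0; apply/bigcupsP => p pX.
  have : p \in [set p in X | p.1 != setT] by rewrite inE.
  by rewrite e0 inE.
have sY : [set p in X | p.1 != setT] \subset X by apply/subsetP => p; rewrite inE => /andP[].
have [p pY pmax] := chain_max bX sY qY; move: (pY); rewrite inE => /andP[pX p1].
right; exists p; split=> //; apply/eqP; rewrite eqEsubset left_flat_sup // andbT.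
apply/bigcupsP => q' q'X.
by have [|] := andP (pmax q' _); rewrite ?inE.
Qed.

Lemma right_flatP X : biflag X -> right_flat X = set0 \/
  exists p, [/\ p \in X, p.1 = setT & right_flat X = p.2].
Proof.
move=> bX; case: (set_0Vmem [set p in X | p.1 == setT]) => [e0|[q qY]].
  left; apply/eqP; rewrite -subset0; apply/bigcupsP => p pX.
  have : p \in [set p in X | p.1 == setT] by rewrite inE.
  by rewrite e0 inE.
have sY : [set p in X | p.1 == setT] \subset X by apply/subsetP => p; rewrite inE => /andP[].
have [p pY pmin] := chain_min bX sY qY; move: (pY); rewrite inE => /andP[pX /eqP p1].
right; exists p; split=> //; apply/eqP; rewrite eqEsubset right_flat_sup // andbT.
apply/bigcupsP => q' q'X.
by have [|] := andP (pmin q' _); rewrite ?inE.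
Qed.

Lemma left_flat_flat X : biflag X -> flat (left_flat X).
Proof.
move=> bX; have [->|[p [pX _ ->]]] := left_flatP bX; first exact: flat0.
exact/biflat_flat/(biflag_biflat bX).
Qed.

Lemma right_flat_flat X : biflag X -> flatp (right_flat X).
Proof.
move=> bX; have [->|[p [pX _ ->]]] := right_flatP bX; first exact: flatp0.
exact/biflat_flatp/(biflag_biflat bX).
Qed.

Lemma uncovered_right e X : e \in uncovered X -> e \notin right_flat X.
Proof.
move/uncoveredP=> eX; apply/bigcupP => -[p /andP[pX /eqP p1] e2].
by apply: (eX p pX) => //; rewrite p1.
Qed.

(** Take the largest $F$ that avoids [e] and the $G$ of the first biflat whose $F$ contains [e].
    Everything outside both is uncovered, and by [gap_not_singleton] that is more than [e]. Being
    outside this $G$, it lies in the matching $F$ and so in [p.1]. *)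
Lemma uncovered_left_other X p e : biflag X -> p \in X -> e \in uncovered X -> e \in p.1 ->
  exists2 e', e' != e & (e' \in uncovered X) && (e' \in p.1).
Proof.
move=> bX pX eX ep.
have pY : p \in [set q in X | e \in q.1] by rewrite inE pX.
have sY : [set q in X | e \in q.1] \subset X by apply/subsetP => q; rewrite inE => /andP[].
have [q0 q0Y q0min] := chain_min bX sY pY.
move: (q0Y); rewrite inE => /andP[q0X eq0].
have eq02 : e \notin q0.2 by apply/negP => e2; move/uncoveredP: eX => /(_ q0 q0X eq0 e2).
have [F [fF eF hF]] : exists F, [/\ flat F, e \notin F &
    forall q, q \in X -> e \notin q.1 -> q.1 \subset F].
  have sY0 : [set q in X | e \notin q.1] \subset X by apply/subsetP => q; rewrite inE => /andP[].
  case: (set_0Vmem [set q in X | e \notin q.1]) => [e0|[q qY]].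
    (* If no $F$ avoids [e], the empty set takes its place; it is a flat because there are no
       loops. *)
    exists set0; split; rewrite ?inE ?flat0 // => q qX eq.
    have : q \in [set q in X | e \notin q.1] by rewrite inE qX.
    by rewrite e0 inE.
  have [q1 q1Y q1max] := chain_max bX sY0 qY; move: (q1Y); rewrite inE => /andP[q1X eq1].
  exists q1.1; split=> // [|q' q'X eq']; first exact/biflat_flat/(biflag_biflat bX).
  by have [|] := andP (q1max q' _); rewrite ?inE ?q'X.
have fG := biflat_flatp (biflag_biflat bX q0X).
have [y ye /andP[yF yG]] := gap_not_singleton bases_matroid bases_card fF fG eF eq02.
exists y => //; apply/andP; split.
  apply/uncoveredP => q qX yq1 yq2; case: (boolP (e \in q.1)) => eq.
    have [|_ /subsetP/(_ _ yq2)] := andP (q0min q _); first by rewrite inE qX.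
    by rewrite (negPf yG).
  by case/negP: yF; apply: (subsetP (hF q qX eq)).
have /andP[/subsetP s1 _] := q0min p pY; apply: s1.
exact: biflat_cover (biflag_biflat bX q0X) yG.
Qed.

(* Multiplying by [gam] with an index outside [p.1] strictly increases the largest proper flat. *)
Lemma gam_kills k X p i : p \in X -> p.1 != setT -> r < rk p.1 + k ->
  vanishes (gam i ^+ k * xmon X)%R.
Proof.
elim: k X p => [|k IHk] X p pX p1 le; apply: xmon_biflag => bX.
  have := flat_rk_lt bases_matroid bases_card (biflat_flat (biflag_biflat bX pX)) p1.
  by move=> lt; exfalso; lia.
have [c cp] : exists c, c \notin p.1.
  by have /subsetPn[c _ cp] : ~~ (setT \subset p.1); [rewrite subTset | exists c].
apply: (@gam_step _ _ _ _ c) => q bq cq q1 bqX.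
apply: (IHk _ q) => //; first exact: setU11.
have sp : p.1 \subset q.1.
  have /orP[/andP[]//|/andP[s _]] := biflag_compatible bqX (setU1r _ pX) (setU11 _ _).
  by case/negP: cp; apply: (subsetP s).
apply: leq_trans le _; rewrite addnS -addSn leq_add2r.
apply: leq_trans (flat_rk_setU1 bases_matroid (biflat_flat (biflag_biflat bX pX)) cp) _.
by rewrite rk_mono // subUset sub1set cq.
Qed.

(* [S] collects the labels of the biflats with F proper, [T] those of the biflats E|G. *)
Definition labelled X S T : bool :=
  [&& S \subset left_flat X, T \subset right_flat X, indepp T, [disjoint S & T] &
      [disjoint S :|: T & uncovered X]].

Lemma uncoveredS X Y : X \subset Y -> uncovered Y \subset uncovered X.
Proof.
move=> sXY; rewrite setCS; apply/bigcupsP => p pX.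
by apply: (bigcup_sup p); rewrite ?(subsetP sXY).
Qed.

Lemma labelled_notin X S T e : labelled X S T -> e \in uncovered X -> e \notin S :|: T.
Proof. by case/and5P=> _ _ _ _ d eX; apply/negP => /(disjointFr d); rewrite eX. Qed.

Lemma labelled_cards X S T : labelled X S T -> #|S :|: T| = #|S| + #|T|.
Proof. by case/and5P=> _ _ _ d _; rewrite cardsU (disjoint_setI0 d) cards0 subn0. Qed.

(** [T] stays independent because it lies in the flat [right_flat X], which misses the uncovered
    [e]. The left side has no such argument: a biflat with both parts proper can leave [e] uncovered
    inside [left_flat X], so [labelled] asks independence of [T] only. *)
Lemma labelled_insert X S T p e : biflag X -> labelled X S T -> e \in uncovered X ->
  e \in p.1 -> e \in p.2 ->
  exists S' T', [/\ labelled (p |: X) S' T', S' :|: T' = e |: (S :|: T) &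
    S' = (if p.1 == setT then S else e |: S) /\ T' = (if p.1 == setT then e |: T else T)].
Proof.
move=> bX lX eX e1 e2; have sX : X \subset p |: X := subsetUr _ _.
have := labelled_notin lX eX; rewrite inE negb_or => /andP[eS eT].
case/and5P: (lX) => sS sT iT dST dX.
have pX := setU11 p X.
have dX' : [disjoint e |: (S :|: T) & uncovered (p |: X)].
  rewrite -setI_eq0 -subset0; apply/subsetP => y; rewrite in_setI in_setU1.
  case/andP=> /orP[/eqP->|yST] yX.
    by move/uncoveredP: yX => /(_ p pX e1 e2).
  by have := disjointFr dX yST; rewrite (subsetP (uncoveredS sX)).
case: (eqVneq p.1 setT) => p1.
  exists S, (e |: T); split=> //; last by rewrite setUCA.
  rewrite /labelled (subset_trans sS) ?left_flatS //= subUset sub1set.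
  rewrite (subsetP (right_flat_sup pX p1) _ e2) (subset_trans sT) ?right_flatS //=.
  rewrite setUCA dX' andbT; apply/andP; split.
    apply: indep_setU1 => //; first exact: bases'_card.
    apply: contraNN (uncovered_right eX) => ec.
    by apply: (subsetP (flat_clS bases'_matroid bases'_card sT (right_flat_flat bX))).
  rewrite disjoint_sym -setI_eq0 setIUl setU_eq0; apply/andP; split; last first.
    by rewrite setI_eq0 disjoint_sym.
  by rewrite setI_eq0 disjoints1.
exists (e |: S), T; split=> //; last by rewrite setUA.
rewrite /labelled subUset sub1set (subsetP (left_flat_sup pX p1) _ e1).
rewrite (subset_trans sS) ?left_flatS // (subset_trans sT) ?right_flatS // iT -setUA dX' andbT /=.
by rewrite -setI_eq0 setIUl setU_eq0 !setI_eq0 disjoints1 eT dST.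
Qed.

End Biflags.

(** * Terms killed by the remaining powers of gamma and delta *)

Section Vanishing.
Variables (n r : nat) (bases : {set {set 'I_n.+1}}) (R : comNzRingType).
Local Notation E := 'I_n.+1.
Hypothesis bases_matroid : is_matroid_bases bases.
Hypothesis bases_card : forall B, B \in bases -> #|B| = r.+1.
Hypothesis loopless : forall x : E, exists2 B, B \in bases & x \in B.
Hypothesis coloopless : forall x : E, exists2 B, B \in bases & x \notin B.
Local Notation rk := (mrank bases).
Local Notation rkp := (mrank (dual_bases bases)).
Local Notation indep := (Defs.indep bases).
Local Notation indepp := (Defs.indep (dual_bases bases)).
Local Notation flat := (is_flat bases).
Local Notation xmon := (xmon bases R).
Local Notation gam := (gam bases R).
Local Notation del := (del bases R).
Local Notation biflag := (is_biflag bases).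
Local Notation labelled := (labelled bases).
Implicit Types (p q : {set E} * {set E}) (X Y : {set {set E} * {set E}}) (S T : {set E}) (e : E).

Let bases'_matroid := dual_bases_matroid bases_matroid bases_card.
Let bases'_card := dual_bases_card bases_card.

Variables (k : nat) (i j : E).
Hypothesis k_le_r : k <= r.
Local Notation weight N X := (gam i ^+ k * del j ^+ N * xmon X)%R.

Let r_lt_n : r < n. Proof. exact: ltn_rank_ground bases_card coloopless. Qed.

(* If every label has been placed, then [S] lies in the largest proper flat [A], [T] is
   independent in the dual, and [r + 1 - rk A > k]; together with an uncovered element this
   leaves no room in [A] for an element that is not a label. *)
Lemma unlabelled_vanishes N X S T : labelled X S T -> #|S| + #|T| + N = n - k - 1 ->
  ~~ (left_flat X \subset S :|: T) -> vanishes (weight N X).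
Proof.
elim: N X S T => [|N IHN] X S T lX eN nsub; apply: xmon_biflag => bX; last first.
  (* The next label must leave some element of [left_flat X] unlabelled. If the known one, [l], is
     covered, any uncovered [e] differs from it. If [l] is uncovered, [l] itself is inserted and a
     second uncovered element of the same flat takes over. *)
  have [e [eX step]] : exists e, e \in uncovered X /\
      forall S' T', S' :|: T' = e |: (S :|: T) -> ~~ (left_flat X \subset S' :|: T').
    have [l lL lST] := subsetPn nsub.
    case: (boolP (l \in uncovered X)) => lU; last first.
      have [e eX] := set0Pn _ (biflag_uncovered bX).
      exists e; split=> // S' T' ->; apply/subsetPn; exists l => //.
      by rewrite in_setU1 negb_or lST andbT; apply: contraNneq lU => ->.
    have [e0|[p [pX p1 eL]]] := left_flatP bX; first by rewrite e0 inE in lL.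
    rewrite eL in lL.
    have [l' l'l /andP[l'U l'p]] := uncovered_left_other bases_matroid bases_card loopless bX pX lU lL.
    exists l; split=> // S' T' ->; apply/subsetPn; exists l'; first by rewrite eL.
    by rewrite in_setU1 negb_or l'l (labelled_notin lX).
  apply: (del_step eX) => p bp e1 e2 bpX.
  have [S' [T' [lpX eST _]]] := labelled_insert bases_matroid bases_card coloopless bX lX eX e1 e2.
  apply: (IHN _ S' T') => //.
    by rewrite -(labelled_cards lpX) eST cardsU1 (labelled_notin lX eX) (labelled_cards lX) -eN add1n addSn addnS.
  apply: contraNN (step _ _ eST) => s; apply: subset_trans s.
  exact/left_flatS/subsetUr.
rewrite expr0 mulr1.
have [e0|[p [pX p1 eL]]] := left_flatP bX; first by rewrite e0 sub0set in nsub.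
case: (ltnP r (rk p.1 + k)) => [lt|le]; first exact: (gam_kills R bases_matroid bases_card i pX p1).
exfalso; set A := p.1 in eL le *; rewrite eL in nsub.
have [sS sT iT dST dX] := and5P lX; rewrite eL in sS.
have [g gX] := set0Pn _ (biflag_uncovered bX).
have gST := labelled_notin lX gX.
have eT : (S :|: T) :\: A = T :\: A by rewrite setDUl (_ : S :\: A = set0) ?set0U //; apply/eqP; rewrite setD_eq0.
have cST : #|S| + #|T| = #|(S :|: T) :&: A| + #|T :\: A| by rewrite -eT cardsID (labelled_cards lX).
have cA : #|A :&: (S :|: T)| + #|A :\: (S :|: T)| = #|A| by rewrite cardsID.
have cAC := card_setCS A.
have cA' := max_card (mem A); rewrite card_ord in cA'.
have rA := rk_dual bases_matroid bases_card (~: A); rewrite setCK in rA.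
have iTA : indepp (T :\: A) by apply: indepS iT; apply: subsetDl.
have sTA : T :\: A \subset ~: A by rewrite setDE subsetIr.
(* By the dual rank formula and the label count, the last two terms exceed [#|T :\: A|] by exactly
   [rk A + k + 1 - r], which is at most 1 here. The contradictory 2 comes from two uncovered
   elements of [A], or from one unlabelled element of [A] and from [g] outside [A], which extends
   [T :\: A] independently. *)
have key : #|T :\: A| + 2 <= rkp (~: A) + #|A :\: (S :|: T)|.
  case: (boolP (g \in A)) => gA; last first.
    have gT : g \notin T by apply: contraNN gST => gT; rewrite inE gT orbT.
    have u1 : 0 < #|A :\: (S :|: T)| by rewrite card_gt0 setD_eq0.
    have ig : indepp (g |: T :\: A).
      apply: (indep_setU1 bases'_matroid bases'_card iTA).
      apply: contraNN (uncovered_right gX) => gc.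
      apply: (subsetP (flat_clS bases'_matroid bases'_card _ (right_flat_flat bases_matroid bases_card coloopless bX))) gc.
      exact: subset_trans (subsetDl _ _) sT.
    have := indep_rk ig (A := ~: A); rewrite subUset sub1set inE gA sTA => /(_ isT).
    rewrite cardsU1 inE (negPf gT) andbF add1n => le'.
    by rewrite addn2 -addn1; apply: leq_add.
  have [g' g'g /andP[g'X g'A]] := uncovered_left_other bases_matroid bases_card loopless bX pX gX gA.
  have u2 : 2 <= #|A :\: (S :|: T)|.
    have c2 : #|[set g; g']| = 2 by rewrite cards2 eq_sym g'g.
    rewrite -c2; apply: subset_leq_card; rewrite subUset !sub1set !in_setD gA g'A gST.
    by rewrite (labelled_notin lX).
  exact: leq_add (indep_rk iTA sTA) u2.
rewrite setIC in cST; rewrite addn0 in eN.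
move: r_lt_n k_le_r le eN cST cA cAC cA' rA key; clear.
move: #|S| #|T| #|A| #|~: A| #|_ :&: _| #|T :\: _| #|A :\: _| (rk _) (rkp _).
move=> *; lia.
Qed.

(** If the whole left flat were labelled, the complement of [p.2] would lie in [S], because [e] and
    [T] lie in [p.2]. But this complement is a nonempty union of circuits, and [S] is independent.
    So [unlabelled_vanishes] applies. *)
Lemma mixed_vanishes N X S T p e : biflag X -> biflag (p |: X) -> labelled X S T -> indep S ->
  e \in uncovered X -> e \in p.1 -> e \in p.2 -> p.1 != setT -> p.2 != setT ->
  #|S| + #|T| + N.+1 = n - k - 1 -> vanishes (weight N (p |: X)).
Proof.
move=> bX bpX lX iS eX e1 e2 p1 p2 eN.
have [S' [T' [lpX eST [eS' eT']]]] := labelled_insert bases_matroid bases_card coloopless bX lX eX e1 e2.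
apply: (unlabelled_vanishes lpX).
  by rewrite -(labelled_cards lpX) eST cardsU1 (labelled_notin lX eX) (labelled_cards lX) -eN add1n addSn addnS.
rewrite eST; apply/negP => sL.
have bp := biflag_biflat bpX (setU11 p X).
have sp : p.1 \subset e |: (S :|: T).
  by apply: subset_trans sL; apply: left_flat_sup; rewrite ?setU11.
have Tp : T \subset p.2.
  case/and5P: (lX) => _ sT _ _ _; apply: subset_trans sT _; apply/bigcupsP => q /andP[qX /eqP q1].
  have /orP[/andP[//]|/andP[s _]] := biflag_compatible bpX (setU11 p X) (setU1r p qX).
  by move: p1; rewrite -subTset -q1 s.
have sC : ~: p.2 \subset S.
  apply/subsetP => y; rewrite inE => yp2.
  have := subsetP sp _ (biflat_cover bp yp2); rewrite in_setU1 inE.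
  case/or3P => [/eqP ye|//|yT]; first by rewrite ye e2 in yp2.
  by rewrite (subsetP Tp) in yp2.
have [c _ cp2] : exists2 c, c \in setT & c \notin p.2 by apply/subsetPn; rewrite subTset.
have := mem_clp bases_matroid bases_card cp2.
rewrite /Defs.clp (flat_cl (biflat_flatp bp)) (negPf cp2) => /esym/negbFE.
move/(subsetP (clS bases_matroid bases_card (setSD [set c] sC))).
have cS : c \in S by rewrite (subsetP sC) // inE.
by apply/negP/(indep_notin_cl bases_matroid); rewrite ?setD1K // !inE eqxx.
Qed.

Definition pure X : bool := [forall p in X, (p.1 == setT) || (p.2 == setT)].

(** An excess of rank over labels persists: a pure insertion raises the rank on the side of the new
    label by at least one, and other insertions vanish. At the end the ranks are at most $r-k$ and
    $n-r-1$, whose sum is the number of labels, so no excess is possible. *)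
Lemma slack_vanishes N X S T : labelled X S T -> indep S -> S \subset left_flat X -> pure X ->
  #|S| + #|T| + N = n - k - 1 ->
  (#|S| < rk (left_flat X)) || (#|T| < rkp (right_flat X)) -> vanishes (weight N X).
Proof.
elim: N X S T => [|N IHN] X S T lX iS sS pX eN slack; apply: xmon_biflag => bX.
  rewrite expr0 mulr1.
  have [_ sT iT _ _] := and5P lX.
  have [leS leT] := (indep_rk iS sS, indep_rk iT sT).
  case: (ltnP r (rk (left_flat X) + k)) => [lt|le].
    have [e0|[p [pX' p1 eL]]] := left_flatP bX.
      have := rk_le_card bases_matroid (set0 : {set E}); rewrite cards0 leqn0 => /eqP rk0.
      by rewrite e0 rk0 add0n ltnNge k_le_r in lt.
    by apply: (gam_kills R bases_matroid bases_card i pX' p1); rewrite -eL.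
  exfalso; have [g gX] := set0Pn _ (biflag_uncovered bX).
  have : right_flat X != setT by apply: contraNneq (uncovered_right gX) => ->; rewrite inE.
  move/(flat_rk_lt bases'_matroid bases'_card (right_flat_flat bases_matroid bases_card coloopless bX)).
  move: leS leT le eN slack r_lt_n k_le_r; move: #|S| #|T| (rk _) (rkp _); clear.
  by move=> s t a b ? ? ? ? /orP[]; lia.
have [e eX] := set0Pn _ (biflag_uncovered bX).
apply: (del_step eX) => p bp e1 e2 bpX.
case: (boolP ((p.1 == setT) || (p.2 == setT))) => [pp|]; last first.
  rewrite negb_or => /andP[p1 p2]; exact: mixed_vanishes bX bpX lX iS eX e1 e2 p1 p2 eN.
have [S' [T' [lpX eST [eS' eT']]]] := labelled_insert bases_matroid bases_card coloopless bX lX eX e1 e2.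
have sX : X \subset p |: X := subsetUr _ _.
have eNe := labelled_notin lX eX; move: (eNe); rewrite inE negb_or => /andP[eS eT].
have fL := left_flat_flat bases_matroid loopless bX.
have fR := right_flat_flat bases_matroid bases_card coloopless bX.
have eR : e \notin right_flat X := uncovered_right eX.
have rkL := rk_mono bases_matroid (left_flatS sX).
have rkR := rk_mono bases'_matroid (right_flatS sX).
have sS' : S' \subset left_flat (p |: X) by case/and5P: lpX.
have eN' : #|S'| + #|T'| + N = n - k - 1.
  by rewrite -(labelled_cards lpX) eST cardsU1 eNe (labelled_cards lX) -eN add1n addSn addnS.
have pp' : pure (p |: X).
  apply/forall_inP => q; rewrite in_setU1 => /orP[/eqP->//|qX].
  exact: (forall_inP pX).
move: eS' eT'; case: (eqVneq p.1 setT) => [p1|p1] eS' eT'; subst S' T'.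
  apply: IHN lpX _ _ pp' eN' _ => //.
  rewrite cardsU1 eT /=; case/orP: slack => lt; apply/orP; [left|right].
    exact: leq_trans lt rkL.
  apply: leq_ltn_trans lt _; apply: leq_trans (flat_rk_setU1 bases'_matroid fR eR) _.
  by rewrite rk_mono // subUset sub1set right_flatS // (subsetP (right_flat_sup (setU11 p X) p1)).
(* In a pure biflag an element of the left flat lies in some biflat $F|E$ and is therefore
   covered. *)
have eL : e \notin left_flat X.
  apply/bigcupP => -[q /andP[qX q1] eq]; move/forall_inP/(_ _ qX): pX; rewrite (negPf q1) /=.
  by move=> /eqP q2; move/uncoveredP: eX => /(_ q qX eq); rewrite q2 inE; apply.
apply: IHN lpX _ sS' pp' eN' _.
  apply: (indep_setU1 bases_matroid bases_card iS); apply: contraNN eL.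
  exact: (subsetP (flat_clS bases_matroid bases_card sS fL)).
rewrite cardsU1 eS /=; case/orP: slack => lt; apply/orP; [left|right].
  apply: leq_ltn_trans lt _; apply: leq_trans (flat_rk_setU1 bases_matroid fL eL) _.
  by rewrite rk_mono // subUset sub1set left_flatS // (subsetP (left_flat_sup (setU11 p X) p1)).
exact: leq_trans lt rkR.
Qed.

End Vanishing.

(** * Expansion of the mixed powers *)

Section SortedSets.
Variable n : nat.
Local Notation E := 'I_n.+1.
Implicit Types (A : {set E}) (e x y : E).

Definition upto x A : {set E} := [set y in A | x <= y].

Lemma upto_sub x A : upto x A \subset A.
Proof. by apply/subsetP => y; rewrite inE => /andP[]. Qed.

Lemma upto_setU1 x e A : (forall y, y \in A -> e < y) -> x \in A -> upto x (e |: A) = upto x A.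
Proof.
move=> lt xA; apply/setP => y; rewrite !inE; case: (eqVneq y e) => //= ->.
by rewrite leqNgt lt // andbF.
Qed.

Lemma upto_all e A : (forall y, y \in A -> e < y) -> upto e (e |: A) = e |: A.
Proof.
move=> lt; apply/setP => y; rewrite inE; apply: andb_idr; rewrite in_setU1.
by case/orP => [/eqP->//|/lt/ltnW].
Qed.

Lemma upto_min A : A != set0 -> exists2 x, x \in A & upto x A = A.
Proof.
case/set0Pn => z zA; case: (arg_minnP (@nat_of_ord _) zA) => x xA xmin.
by exists x => //; apply/setP => y; rewrite inE; apply: andb_idr => /xmin.
Qed.

Lemma mem_sort_dec A x : (x \in sort_dec A) = (x \in A).
Proof. by rewrite mem_sort mem_enum. Qed.

Lemma mem_sort_inc A x : (x \in sort_inc A) = (x \in A).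
Proof. by rewrite mem_sort mem_enum. Qed.

Lemma size_sort_dec A : size (sort_dec A) = #|A|.
Proof. by rewrite size_sort cardE. Qed.

Lemma size_sort_inc A : size (sort_inc A) = #|A|.
Proof. by rewrite size_sort cardE. Qed.

Lemma uniq_sort_dec A : uniq (sort_dec A).
Proof. by rewrite sort_uniq enum_uniq. Qed.

Lemma uniq_sort_inc A : uniq (sort_inc A).
Proof. by rewrite sort_uniq enum_uniq. Qed.

Lemma index_sort_dec A x y : x \in A -> y \in A ->
  (index y (sort_dec A) <= index x (sort_dec A)) = (x <= y).
Proof.
move=> xA yA; have sA : sorted (fun x y : E => y <= x) (sort_dec A).
  by apply: sort_sorted => a b; apply: leq_total.
have tr : transitive (fun x y : E => y <= x) by move=> b a c ba cb; apply: leq_trans cb ba.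
have le := sorted_leq_index tr (fun z : E => leqnn z) sA.
apply/idP/idP => [|xy]; first by apply: le; rewrite mem_sort_dec.
rewrite leqNgt; apply/negP => lt.
have yx : y <= x by apply: (le x y); rewrite ?mem_sort_dec // ltnW.
have exy : x = y by apply/val_inj/eqP; rewrite eqn_leq xy.
by rewrite exy ltnn in lt.
Qed.

Lemma index_sort_inc A x y : x \in A -> y \in A ->
  (index x (sort_inc A) <= index y (sort_inc A)) = (x <= y).
Proof.
move=> xA yA; have sA : sorted (fun x y : E => x <= y) (sort_inc A).
  by apply: sort_sorted => a b; apply: leq_total.
have tr : transitive (fun x y : E => x <= y) by move=> b a c; apply: leq_trans.
have le := sorted_leq_index tr (fun z : E => leqnn z) sA.
apply/idP/idP => [|xy]; first by apply: le; rewrite mem_sort_inc.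
rewrite leqNgt; apply/negP => lt.
have yx : y <= x by apply: (le y x); rewrite ?mem_sort_inc // ltnW.
have exy : x = y by apply/val_inj/eqP; rewrite eqn_leq xy.
by rewrite exy ltnn in lt.
Qed.

Lemma set_of_take A x : x \in A ->
  Defs.set_of (take (index x (sort_dec A)).+1 (sort_dec A)) = upto x A.
Proof.
move=> xA; apply/setP => y; rewrite !inE; case: (boolP (y \in A)) => yA /=.
  by rewrite in_take ?mem_sort_dec // ltnS index_sort_dec.
by apply: contraNF yA => /mem_take; rewrite mem_sort_dec.
Qed.

Lemma set_of_drop A x : x \in A ->
  Defs.set_of (drop (index x (sort_inc A)) (sort_inc A)) = upto x A.
Proof.
move=> xA; apply/setP => y; rewrite !inE; case: (boolP (y \in A)) => yA /=; last first.
  by apply: contraNF yA => /mem_drop; rewrite mem_sort_inc.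
have ys : y \in sort_inc A by rewrite mem_sort_inc.
rewrite -(index_sort_inc xA yA) leqNgt -(in_take _ ys).
have := uniq_sort_inc A; rewrite -{1}(cat_take_drop (index x (sort_inc A)) (sort_inc A)) cat_uniq.
case/and3P=> _ /hasPn nd _; move: (ys).
rewrite -{1}(cat_take_drop (index x (sort_inc A)) (sort_inc A)) mem_cat.
by case: (boolP (y \in drop _ _)) => [/nd/= /negPf->|_] //; rewrite orbF => ->.
Qed.

End SortedSets.

(** * Split biflags and the branching rule for delta *)

Section Expansion.
Variables (n r : nat) (bases : {set {set 'I_n.+1}}) (R : comNzRingType).
Local Notation E := 'I_n.+1.
Hypothesis bases_matroid : is_matroid_bases bases.
Hypothesis bases_card : forall B, B \in bases -> #|B| = r.+1.
Hypothesis loopless : forall x : E, exists2 B, B \in bases & x \in B.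
Hypothesis coloopless : forall x : E, exists2 B, B \in bases & x \notin B.
Local Notation rk := (mrank bases).
Local Notation rkp := (mrank (dual_bases bases)).
Local Notation cl := (Defs.cl bases).
Local Notation clp := (Defs.clp bases).
Local Notation indep := (Defs.indep bases).
Local Notation indepp := (Defs.indep (dual_bases bases)).
Local Notation flat := (is_flat bases).
Local Notation flatp := (is_flat (dual_bases bases)).
Local Notation xmon := (xmon bases R).
Local Notation gam := (gam bases R).
Local Notation del := (del bases R).
Local Notation biflat := (is_biflat bases).
Local Notation biflag := (is_biflag bases).
Local Notation labelled := (labelled bases).
Local Notation gap := (gap bases).
Local Notation SB := (SB bases).
Local Notation "f === g" := (chow_eq f g) (at level 70).
Implicit Types (p q : {set E} * {set E}) (X Y : {set {set E} * {set E}}) (B S T : {set E})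
  (e x y : E).

Let bases'_matroid := dual_bases_matroid bases_matroid bases_card.
Let bases'_card := dual_bases_card bases_card.
Let r_lt_n : r < n. Proof. exact: ltn_rank_ground bases_card coloopless. Qed.
Let cl_0 : cl set0 = set0. Proof. exact: cl0. Qed.
Let clp_0 : clp set0 = set0. Proof. exact/eqP/(flatp0 bases_matroid bases_card coloopless). Qed.

Lemma biflagS X Y : X \subset Y -> biflag Y -> biflag X.
Proof.
move=> sXY bY; apply/andP; split; first (apply/andP; split).
- by apply/forall_inP => p /(subsetP sXY); apply: biflag_biflat.
- apply/forall_inP => p /(subsetP sXY) pY; apply/forall_inP => q /(subsetP sXY).
  exact: biflag_compatible bY pY.
- have /set0Pn[e eY] := biflag_uncovered bY.
  have := subsetP (uncoveredS sXY) _ eY; rewrite inE.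
  by apply: contraNneq => ->; rewrite inE.
Qed.

(* The labels are inserted in decreasing order, so [upto x S] consists of [x] and the labels
   placed before it. *)
Definition split_biflag S T : {set {set E} * {set E}} :=
  [set (cl (upto x S), setT) | x in S] :|: [set (setT, clp (upto y T)) | y in T].

Lemma split_biflagP S T p : reflect
  ((exists2 x, x \in S & p = (cl (upto x S), setT)) \/
   (exists2 y, y \in T & p = (setT, clp (upto y T)))) (p \in split_biflag S T).
Proof.
rewrite inE; apply: (iffP orP) => -[h|h].
- by left; apply/imsetP.
- by right; apply/imsetP.
- by left; apply/imsetP.
- by right; apply/imsetP.
Qed.

Lemma split_biflag_left S T : S != set0 -> (cl S, setT) \in split_biflag S T.
Proof.
by case/upto_min => x xS eS; apply/split_biflagP; left; exists x => //; rewrite eS.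
Qed.

Lemma split_biflag_right S T : T != set0 -> (setT, clp T) \in split_biflag S T.
Proof.
by case/upto_min => y yT eT; apply/split_biflagP; right; exists y => //; rewrite eT.
Qed.

Lemma split_biflag_setU1l S T e : (forall y, y \in S -> e < y) ->
  split_biflag (e |: S) T = (cl (e |: S), setT) |: split_biflag S T.
Proof.
move=> lt; apply/setP => p; rewrite in_setU1; apply/split_biflagP/orP.
  case=> [[x]|[y yT ->]].
    rewrite in_setU1 => /orP[/eqP->|xS] ->; first by left; rewrite upto_all.
    by right; rewrite upto_setU1 //; apply/split_biflagP; left; exists x.
  by right; apply/split_biflagP; right; exists y.
case=> [/eqP->|/split_biflagP[[x xS ->]|[y yT ->]]].
- by left; exists e; rewrite ?setU11 ?upto_all.
- by left; exists x; rewrite ?upto_setU1 // setU1r.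
- by right; exists y.
Qed.

Lemma split_biflag_setU1r S T e : (forall y, y \in T -> e < y) ->
  split_biflag S (e |: T) = (setT, clp (e |: T)) |: split_biflag S T.
Proof.
move=> lt; apply/setP => p; rewrite in_setU1; apply/split_biflagP/orP.
  case=> [[x xS ->]|[y]].
    by right; apply/split_biflagP; left; exists x.
  rewrite in_setU1 => /orP[/eqP->|yT] ->; first by left; rewrite upto_all.
  by right; rewrite upto_setU1 //; apply/split_biflagP; right; exists y.
case=> [/eqP->|/split_biflagP[[x xS ->]|[y yT ->]]].
- by right; exists e; rewrite ?setU11 ?upto_all.
- by left; exists x.
- by right; exists y; rewrite ?upto_setU1 // setU1r.
Qed.

Lemma pure_split_biflag S T : pure (split_biflag S T).
Proof.
by apply/forall_inP => p /split_biflagP[[x _ ->]|[y _ ->]]; rewrite eqxx ?orbT.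
Qed.

Lemma uncovered_split_biflag S T : uncovered (split_biflag S T) = gap S T.
Proof.
apply/setP => e; apply/uncoveredP/gapP => [eX|[eS eT] p].
  split; apply/negP => ec.
    case: (eqVneq S set0) => [S0|/(split_biflag_left T)/eX]; first by rewrite S0 cl_0 inE in ec.
    by apply; rewrite // inE.
  case: (eqVneq T set0) => [T0|/(split_biflag_right S)/eX]; first by rewrite T0 clp_0 inE in ec.
  by apply; rewrite // inE.
case/split_biflagP => [[x _ ->]|[y _ ->]] /= e1 e2.
  by case/negP: eS; apply: (subsetP (clS bases_matroid bases_card (upto_sub x S))).
by case/negP: eT; apply: (subsetP (clS bases'_matroid bases'_card (upto_sub y T))).
Qed.

Lemma cl_upto_neqT S x : cl S != setT -> cl (upto x S) != setT.
Proof.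
rewrite -!subTset; apply: contraNN => s; apply: subset_trans s _.
exact: (clS bases_matroid bases_card (upto_sub x S)).
Qed.

Lemma left_split_biflag S T : cl S != setT -> left_flat (split_biflag S T) = cl S.
Proof.
move=> SnT; apply/eqP; rewrite eqEsubset; apply/andP; split.
  apply/bigcupsP => p /andP[/split_biflagP[[x _ ->]|[y _ ->]]] /=; last by rewrite eqxx.
  by move=> _; apply: (clS bases_matroid bases_card (upto_sub x S)).
case: (eqVneq S set0) => [->|/(split_biflag_left T) SX]; first by rewrite cl_0 sub0set.
exact: (left_flat_sup SX).
Qed.

Lemma right_split_biflag S T : cl S != setT -> right_flat (split_biflag S T) = clp T.
Proof.
move=> SnT; apply/eqP; rewrite eqEsubset; apply/andP; split.
  apply/bigcupsP => p /andP[/split_biflagP[[x _ ->]|[y _ ->]]] /=.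
    by rewrite (negPf (cl_upto_neqT x SnT)).
  by move=> _; apply: (clS bases'_matroid bases'_card (upto_sub y T)).
case: (eqVneq T set0) => [->|/(split_biflag_right S) TX]; first by rewrite clp_0 sub0set.
exact: (right_flat_sup TX).
Qed.

Lemma labelled_split_biflag S T : cl S != setT -> indepp T -> [disjoint S & T] ->
  labelled (split_biflag S T) S T.
Proof.
move=> SnT iT dST; apply/and5P; rewrite left_split_biflag // right_split_biflag //.
split=> //; [exact: sub_cl | exact: sub_cl |].
rewrite uncovered_split_biflag disjoint_sym -setI_eq0 -subset0.
apply/subsetP => e; rewrite in_setI => /andP[eg eU].
by have := gap_notin eg; rewrite eU.
Qed.

Variables (k : nat) (i j : E).
Hypothesis k_le_r : k <= r.
Local Notation weight N X := (gam i ^+ k * del j ^+ N * xmon X)%R.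

Lemma setT_setT_not_biflag X : (setT, setT) \in X -> ~~ biflag X.
Proof.
move=> pX; apply/negP => bX; have := biflag_biflat bX pX.
by case/and5P=> _ _ _ _; rewrite /= eqxx.
Qed.

(** Compatibility with the largest biflat on its side makes a pure [p] contain [S] or [T] besides
    [e]. Its flat thus contains the closure named in the exceptions, strictly as [p] is not one of
    them, and the surplus of rank is the slack of [slack_vanishes]. *)
Lemma step_vanishes N S T e p : let X := split_biflag S T in
  indep S -> indepp T -> [disjoint S & T] -> cl S != setT ->
  #|S| + #|T| + N.+1 = n - k - 1 -> e \in gap S T -> e \in p.1 -> e \in p.2 ->
  p != (cl (e |: S), setT) -> p != (setT, clp (e |: T)) -> vanishes (weight N (p |: X)).
Proof.
move=> X iS iT dST SnT eN eg e1 e2 p1 p2; apply: xmon_biflag => bpX.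
have eX : e \in uncovered X by rewrite uncovered_split_biflag.
have lX : labelled X S T by apply: labelled_split_biflag.
have bX : biflag X by apply: biflagS bpX; apply: subsetUr.
have bp := biflag_biflat bpX (setU11 p X).
have [eS eT] := gapP _ _ _ _ eg.
have eST := gap_notin eg; move: (eST); rewrite inE negb_or => /andP[enS enT].
case: (boolP ((p.1 == setT) || (p.2 == setT))) => [pp|]; last first.
  rewrite negb_or => /andP[q1 q2].
  exact: (mixed_vanishes _ bases_matroid bases_card loopless coloopless _ _ k_le_r bX bpX lX iS eX e1 e2 q1 q2 eN).
have [S' [T' [lpX eU [eS' eT']]]] := labelled_insert bases_matroid bases_card coloopless bX lX eX e1 e2.
have pure' : pure (p |: X).
  apply/forall_inP => q; rewrite in_setU1 => /orP[/eqP->//|qX].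
  exact: (forall_inP (pure_split_biflag S T)).
have sS' : S' \subset left_flat (p |: X) by case/and5P: lpX.
have eN' : #|S'| + #|T'| + N = n - k - 1.
  by rewrite -(labelled_cards lpX) eU cardsU1 eST (labelled_cards lX) -eN add1n addSn addnS.
have iS' : indep S'.
  by rewrite eS'; case: ifP => // _; apply: (indep_setU1 bases_matroid bases_card).
apply: (slack_vanishes _ bases_matroid bases_card loopless coloopless _ _ k_le_r lpX iS' sS' pure' eN').
move: eS' eT'; case: (eqVneq p.1 setT) => [q1|q1] eS' eT'; subst S' T'; apply/orP.
  right; have sT : T \subset p.2.
    case: (eqVneq T set0) => [->|Tn0]; first exact: sub0set.
    apply: subset_trans (sub_cl (dual_bases bases) T) _.
    have /orP[/andP[]//|/andP[_ s]] := biflag_compatible bpX (setU11 p X) (setU1r p (split_biflag_right S Tn0)).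
    by move/subsetP/(_ _ e2): s; rewrite (negPf eT).
  have ieT : indepp (e |: T) by apply: (indep_setU1 bases'_matroid bases'_card).
  have scl := cl_setU1 bases'_matroid bases'_card (biflat_flatp bp) sT e2.
  rewrite -(rk_indep bases'_matroid ieT) -(rk_cl bases'_matroid bases'_card).
  rewrite (leq_trans _ (rk_mono bases'_matroid (right_flat_sup (setU11 p X) q1))) // ltnNge.
  apply/negP => le; case/negP: p2; rewrite /Defs.clp.
  rewrite (flat_rk_eq bases'_matroid (cl_flat bases'_matroid bases'_card _) scl le) -q1.
  by case: (p).
have q2 : p.2 = setT by move: pp; rewrite (negPf q1) => /eqP.
left; have sS : S \subset p.1.
  case: (eqVneq S set0) => [->|Sn0]; first exact: sub0set.
  apply: subset_trans (sub_cl bases S) _.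
  have /orP[/andP[s _]|/andP[]//] := biflag_compatible bpX (setU11 p X) (setU1r p (split_biflag_left T Sn0)).
  by move/subsetP/(_ _ e1): s; rewrite (negPf eS).
have ieS : indep (e |: S) by apply: (indep_setU1 bases_matroid bases_card).
have scl := cl_setU1 bases_matroid bases_card (biflat_flat bp) sS e1.
rewrite -(rk_indep bases_matroid ieS) -(rk_cl bases_matroid bases_card).
rewrite (leq_trans _ (rk_mono bases_matroid (left_flat_sup (setU11 p X) q1))) // ltnNge.
apply/negP => le; case/negP: p1; rewrite /Defs.cl.
rewrite (flat_rk_eq bases_matroid (cl_flat bases_matroid bases_card _) scl le) -q2.
by case: (p).
Qed.

Lemma del_split N S T e : let X := split_biflag S T in
  indep S -> indepp T -> [disjoint S & T] -> cl S != setT ->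
  #|S| + #|T| + N.+1 = n - k - 1 -> e \in gap S T ->
  (forall y, y \in S :|: T -> e < y) ->
  weight N.+1 X === (weight N (split_biflag (e |: S) T) + weight N (split_biflag S (e |: T)))%R.
Proof.
move=> X iS iT dST SnT eN eg lt.
have [eS eT] := gapP _ _ _ _ eg.
have := gap_notin eg; rewrite inE negb_or => /andP[enS enT].
have ieS : indep (e |: S) by apply: (indep_setU1 bases_matroid bases_card).
have ieT : indepp (e |: T) by apply: (indep_setU1 bases'_matroid bases'_card).
rewrite split_biflag_setU1l => [|y yS]; last by rewrite lt // inE yS.
rewrite split_biflag_setU1r => [|y yT]; last by rewrite lt // inE yT orbT.
set p1 := (cl (e |: S), setT); set p2 := (setT, clp (e |: T)).
(* They could agree only as $E|E$, which would need $n-1$ labels in [S] and [T]; there are fewer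
   than $n-k-1$. *)
have p12 : p2 != p1.
  apply/negP => /eqP[h1 h2].
  have := rk_indep bases_matroid ieS; rewrite -(rk_cl bases_matroid bases_card).
  rewrite -/(Defs.cl bases _) -h1 (rk_setT bases_matroid bases_card) cardsU1 enS.
  have := rk_indep bases'_matroid ieT; rewrite -(rk_cl bases'_matroid bases'_card).
  rewrite -/(Defs.clp bases _) h2 (rk_setT bases'_matroid bases'_card) cardsU1 enT.
  move: eN r_lt_n; move: #|S| #|T|; clear => s t; rewrite !add1n; lia.
have eX : e \in uncovered X by rewrite uncovered_split_biflag.
apply: chow_trans (del_expand (gam i ^+ k)%R j N eX) _.
pose F p := weight N (p |: X).
have split_e : (\sum_(p | e \in p.1 :&: p.2) F p = F p1 + (F p2 +
    \sum_(p | [&& e \in p.1 :&: p.2, p != p1 & p != p2]) F p))%R.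
  have ep1 : e \in p1.1 :&: p1.2.
    by rewrite in_setI in_setT andbT (subsetP (sub_cl bases _)) // setU11.
  have ep2 : e \in p2.1 :&: p2.2.
    by rewrite in_setI in_setT (subsetP (sub_cl (dual_bases bases) _)) // setU11.
  rewrite (bigD1 p1) // (bigD1 p2) ?ep2 //=.
  by congr (_ + (_ + _))%R; apply: eq_bigl => p; rewrite -andbA.
(* The sum is enlarged to all pairs, at the cost of vanishing terms, so that [p1] and [p2] can be
   extracted without deciding whether they are biflats. *)
apply: (@chow_trans _ _ _ (\sum_(p | e \in p.1 :&: p.2) F p)%R).
  rewrite [X in _ === X](bigID (is_biflat bases)) /= -[X in X === _]addr0.
  apply: chowD.
    rewrite (eq_bigl (fun p => (e \in p.1 :&: p.2) && biflat p)); first exact: chow_refl.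
    by move=> p; rewrite andbC.
  apply/chow_sym/vanishes_chow0/vanishes_sum => p /andP[_ nb].
  apply: vanishesM; apply: xmon_notbiflag; apply: contraNN nb => b.
  exact: biflag_biflat b (setU11 _ _).
rewrite split_e -[X in _ === X]addr0 -addrA; apply: chowD; first exact: chow_refl.
apply: chowD; first exact: chow_refl.
apply/vanishes_chow0/vanishes_sum => p /and3P[]; rewrite inE => /andP[e1 e2] np1 np2.
exact: (@step_vanishes _ _ _ e).
Qed.

(** * Filling the middle of the extended biflag with powers of gamma *)

Section Extension.
Variable B : {set E}.
Hypotheses (bB : B \in bases) (cIA : #|IA bases B| = k.+1).
Local Notation S := (SB B).
Local Notation T := (TB B).
Local Notation c := (cseq bases B).
Local Notation Fplus := (Fplus bases r k B).

Let cT : #|T| = n - r - 1. Proof. exact: (card_TB bases_card coloopless bB). Qed.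
Let cS : #|S| = r - k. Proof. exact: card_SB. Qed.
Let sTB : T \subset ~: B. Proof. exact: (TB_sub bases_card coloopless bB). Qed.

Let leq_sub1 a b : a < b -> a <= b - 1. Proof. by case: b => // b; rewrite subn1. Qed.

Let iT : indepp T.
Proof.
by apply: indepS sTB (base_indep _); rewrite mem_dual_bases setCK.
Qed.

Let size_c : size c = k.+1. Proof. by rewrite size_sort_dec. Qed.

Definition partial_basis m : {set E} := S :|: Defs.set_of (take m c).

Lemma partial_basis_sub m : partial_basis m \subset B.
Proof.
rewrite subUset subsetDl; apply/subsetP => x; rewrite inE => /mem_take.
by rewrite mem_sort_dec (mem_IA bases_matroid bases_card _ bB) => /andP[].
Qed.

Lemma partial_basis_indep m : indep (partial_basis m).
Proof. exact: indepS (partial_basis_sub m) (base_indep bB). Qed.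

Lemma partial_basis0 : partial_basis 0 = S.
Proof.
by apply/setP => x; rewrite !in_setU [x \in Defs.set_of _]inE take0 in_nil orbF.
Qed.

Lemma partial_basisS m : m < k.+1 ->
  partial_basis m.+1 = nth ord0 c m |: partial_basis m /\ nth ord0 c m \notin partial_basis m.
Proof.
move=> lt; have ltc : m < size c by rewrite size_c.
rewrite /partial_basis (take_nth ord0 ltc); split.
  by apply/setP => x; rewrite !in_setU in_set1 !in_set mem_rcons inE orbCA.
rewrite in_setU negb_or; apply/andP; split.
  by rewrite in_setD negb_and negbK -mem_sort_dec mem_nth.
by rewrite in_set in_take ?mem_nth // index_uniq ?uniq_sort_dec // ltnn.
Qed.

Lemma card_partial_basis m : m <= k.+1 -> #|partial_basis m| = r - k + m.
Proof.
elim: m => [|m IHm] le; first by rewrite partial_basis0 addn0 cS.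
by have [-> nN] := partial_basisS le; rewrite cardsU1 nN IHm ?addnS // ltnW.
Qed.

Lemma partial_basis_mono m m' : m <= m' -> partial_basis m \subset partial_basis m'.
Proof.
move=> le; rewrite setUS //; apply/subsetP => x; rewrite !in_set -(take_takel c le).
exact: mem_take.
Qed.

Definition partial_cover m : bool := cl (partial_basis m) :|: clp T == setT.

Lemma partial_cover_mono m m' : m <= m' -> partial_cover m -> partial_cover m'.
Proof.
rewrite /partial_cover -!subTset => le s; apply: subset_trans s _; rewrite setSU //.
exact: (clS bases_matroid bases_card (partial_basis_mono le)).
Qed.

(** The search for [iB] starts at 0 and the subtraction is truncated, so the values 0 and 1 act
    alike; at a positive index the comparison only asks whether the cover has been reached. *)
Lemma iB_le m : m < k -> (m.+1 <= iB bases k B - 1) = ~~ partial_cover m.+1.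
Proof.
move=> ltm; rewrite /iB -[find _ _]/(find partial_cover (iota 0 k.+2)).
set f := find _ _.
have nth_f l : l < k.+2 -> nth 0 (iota 0 k.+2) l = l by move=> ?; rewrite nth_iota.
apply/idP/idP => [lt|].
  have ltf : m.+1 < f by lia.
  by have := before_find 0 ltf; rewrite nth_f ?ltnS 1?ltnW // => ->.
move=> nP; have : m.+1 < f; last by lia.
rewrite ltnNge; apply: contraNN nP => le.
have lf : f < size (iota 0 k.+2) by rewrite size_iota (leq_ltn_trans le) // !ltnS ltnW.
have := nth_find 0 (a := partial_cover) (s := iota 0 k.+2); rewrite has_find => /(_ lf).
rewrite -/f nth_f; first exact: partial_cover_mono.
by rewrite size_iota in lf.
Qed.

Lemma Fplus_mid m : m < k -> Fplus (r - k + m.+1) =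
  (cl (partial_basis m.+1), if partial_cover m.+1 then clp T else setT).
Proof.
move=> lt; rewrite /Defs.Fplus.
have -> : (r - k + m.+1 <= r - k) = false by apply/negbTE; rewrite -ltnNge -addn1 leq_add2l.
have -> : r - k + m.+1 <= r by lia.
by rewrite addKn iB_le //; case: (partial_cover _).
Qed.

(** The split biflag supplies both ends of the extended biflag; the recursion adds its first [m]
    middle biflats. *)
Fixpoint ext_upto m : {set {set E} * {set E}} :=
  if m is m'.+1 then Fplus (r - k + m) |: ext_upto m' else split_biflag S T.

Lemma ext_uptoP m p : reflect (p \in split_biflag S T \/ exists2 l, l < m & p = Fplus (r - k + l.+1))
  (p \in ext_upto m).
Proof.
elim: m p => [|m IHm] p /=; first by apply: (iffP idP) => [|[//|[]//]]; left.
rewrite in_setU1; apply: (iffP orP) => [[/eqP->|/IHm[]]|[h|[l lm ->]]].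
- by right; exists m.
- by left.
- by case=> l lm ->; right; exists l; rewrite // ltnW.
- by right; apply/IHm; left.
- move: lm; rewrite ltnS leq_eqVlt => /orP[/eqP->|lm]; first by left; rewrite eqxx.
  by right; apply/IHm; right; exists l.
Qed.

Lemma Fplus_low x : x \in S -> Fplus (index x (sort_dec S)).+1 = (cl (upto x S), setT).
Proof.
move=> xS; have ls : index x (sort_dec S) < r - k.
  by rewrite -cS -size_sort_dec index_mem mem_sort_dec.
rewrite /Defs.Fplus ls -set_of_take // /eseq takel_cat //.
by rewrite size_sort_dec cS.
Qed.

Lemma Fplus_high y : y \in T ->
  Fplus (r.+1 + index y (sort_inc T)) = (setT, clp (upto y T)).
Proof.
move=> yT; rewrite /Defs.Fplus; set s := index _ _.
have -> : (r.+1 + s <= r - k) = false by lia.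
have -> : (r.+1 + s <= r) = false by lia.
have -> : r.+1 + s - k - 1 = r - k + s by lia.
rewrite -set_of_drop // /eseq drop_cat size_sort_dec cS -ltn_subRL subnn.
by rewrite ltn0 addKn.
Qed.

Lemma ext_upto_max : ext_upto k = ext_biflag bases r k B.
Proof.
apply/setP => p; apply/ext_uptoP/imsetP.
  case=> [/split_biflagP[[x xS ->]|[y yT ->]]|[l lk ->]].
  - have ls : index x (sort_dec S) < r - k.
      by rewrite -cS -size_sort_dec index_mem mem_sort_dec.
    have ln : (index x (sort_dec S)).+1 < n by lia.
    by exists (Ordinal ln); rewrite ?inE // -Fplus_low.
  - have ls : index y (sort_inc T) < n - r - 1.
      by rewrite -cT -size_sort_inc index_mem mem_sort_inc.
    have ln : r.+1 + index y (sort_inc T) < n by lia.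
    by exists (Ordinal ln); rewrite ?inE // -Fplus_high.
  - have ln : r - k + l.+1 < n by lia.
    by exists (Ordinal ln) => //; rewrite inE /= addnS.
case=> -[l ln]; rewrite inE /= => l0 ->.
case: (leqP l (r - k)) => [le|gt].
  have ls : l.-1 < size (sort_dec S) by rewrite size_sort_dec cS prednK.
  left; apply/split_biflagP; left; exists (nth ord0 (sort_dec S) l.-1).
    by rewrite -mem_sort_dec mem_nth.
  rewrite -Fplus_low; last by rewrite -mem_sort_dec mem_nth.
  by rewrite index_uniq ?uniq_sort_dec // prednK.
case: (leqP l r) => [le|gt'].
  right; exists (l - (r - k)).-1; first by lia.
  by congr (Fplus _); lia.
have ls : l - r.+1 < size (sort_inc T) by rewrite size_sort_inc cT; lia.
left; apply/split_biflagP; right; exists (nth ord0 (sort_inc T) (l - r.+1)).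
  by rewrite -mem_sort_inc mem_nth.
rewrite -Fplus_high; last by rewrite -mem_sort_inc mem_nth.
by rewrite index_uniq ?uniq_sort_inc // subnKC.
Qed.

(** Expand one factor with the next active element [cm] as index. A surviving biflat has an $F$
    containing the previous flat and [cm], and the remaining powers of $\gamma$ cap its rank, so $F$
    is forced. Its $G$ contains [clp T], whose rank is one below the maximum, so $G$ is [clp T] or
    $E$. Without a cover the condition $F\cup G=E$ leaves only $E$; with a cover $G=E$ would leave
    nothing uncovered. *)
Lemma gam_extend m : m < k ->
  (gam i ^+ (k - m) * xmon (ext_upto m) === gam i ^+ (k - m.+1) * xmon (ext_upto m.+1))%R.
Proof.
move=> ltm; have ltm' : m < k.+1 by apply: ltnW.
have [eP cN] := partial_basisS ltm'; set cm := nth ord0 c m in eP cN.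
have iP := partial_basis_indep m.+1.
have cNcl : cm \notin cl (partial_basis m).
  by apply: (indep_notin_cl bases_matroid cN); rewrite -eP.
have eF := Fplus_mid ltm; set F := cl (partial_basis m.+1) in eF.
have rkF : rk F = r - k + m.+1.
  by rewrite (rk_cl bases_matroid bases_card) (rk_indep bases_matroid iP) card_partial_basis.
have FnT : F != setT.
  by apply: contraTneq ltm => FT; move: rkF; rewrite FT (rk_setT bases_matroid bases_card); lia.
have cF : cm \in F by rewrite (subsetP (sub_cl bases _)) // eP setU11.
have rkT : rkp (clp T) = n - r - 1.
  by rewrite (rk_cl bases'_matroid bases'_card) (rk_indep bases'_matroid iT).
have fF : flat F by apply: cl_flat bases_card _.
have fT : flatp (clp T) by apply: cl_flat bases'_card _.
have Fn0 : F != set0 by apply/set0Pn; exists cm.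
set p0 := Fplus _ in eF.
have bp0 : biflat p0.
  rewrite eF /is_biflat /= fF Fn0 (negPf FnT) /=; case: ifP => cov.
    rewrite fT /= (eqP cov) eqxx andbT; apply: contraNneq FnT => T0.
    by move: cov; rewrite /partial_cover T0 setU0.
  rewrite setUT eqxx !andbT; apply/andP; split.
    by rewrite /is_flat eqEsubset subsetT (sub_cl (dual_bases bases)).
  by apply/set0Pn; exists cm.
have cm_below (A : {set E}) : A \subset partial_basis m -> cl A <> F.
  move=> sA eA; case/negP: cNcl; apply: (subsetP (clS bases_matroid bases_card sA)).
  by have -> : mcl bases A = F by apply: eA.
have p0X : p0 \notin ext_upto m.
  apply/negP => /ext_uptoP[/split_biflagP[[x xS]|[y yT]]|[l ltl]]; rewrite eF.
  - case=> eA _; apply: (cm_below (upto x S)) => //.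
    by apply: subset_trans (upto_sub _ _) _; apply: subsetUl.
  - by case=> FT _; rewrite FT eqxx in FnT.
  - rewrite Fplus_mid ?(ltn_trans ltl) // => -[eA _].
    by apply: (cm_below (partial_basis l.+1)) => //; apply: partial_basis_mono.
have em : k - m = (k - m.+1).+1 by rewrite subnSK.
rewrite em; apply: (chow_trans (gam_expand bases R i cm _ _)). 
rewrite (bigD1 p0) /=; last by rewrite bp0 eF /= cF FnT.
rewrite -xmonU1 // -[X in _ === X]addr0; apply: chowD; first exact: chow_refl.
apply/vanishes_chow0/vanishes_sum => p /andP[/andP[/andP[bp cp] pnT] pp0].
have [h ->] := xvarM_xmon bases R p (ext_upto m); rewrite mulrCA; apply: vanishesM.
apply: xmon_biflag => bpX; have pX : p \in p |: ext_upto m by rewrite in_setU1 eqxx.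
have sX (q : {set E} * {set E}) : q \in ext_upto m -> q \in p |: ext_upto m by move=> ?; apply: setU1r.
case: (ltnP r (rk p.1 + (k - m.+1))) => [lt|le].
  exact: (gam_kills R bases_matroid bases_card i pX pnT lt).
(* The previous flat misses [cm], which [p.1] contains, so compatibility puts it below [p.1]. *)
exfalso; have sPp : partial_basis m \subset p.1.
  case: (eqVneq (partial_basis m) set0) => [->|Pn0]; first exact: sub0set.
  apply: subset_trans (sub_cl bases _) _.
  have [q qX q1] : exists2 q, q \in ext_upto m & q.1 = cl (partial_basis m).
    case: (m) ltm Pn0 => [_|l ltl] Pn0.
      rewrite partial_basis0 in Pn0 *; exists (cl S, setT) => //.
      exact: split_biflag_left.
    exists (Fplus (r - k + l.+1)); last by rewrite Fplus_mid // ltnW.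
    exact: setU11.
  have /orP[/andP[s _]|/andP[s _]] := biflag_compatible bpX pX (sX _ qX).
    by case/negP: cNcl; rewrite -q1; apply: (subsetP s).
  by have <- : q.1 = mcl bases (partial_basis m) by apply: q1.
have rkp1 : rk p.1 <= r - k + m.+1.
  by move: le ltm k_le_r; move: (rk _) => a; clear; lia.
have sFp : F \subset p.1.
  by rewrite /F eP; apply: (cl_setU1 bases_matroid bases_card (biflat_flat bp) sPp cp).
have p1F : F = p.1 by apply: (flat_rk_eq bases_matroid fF sFp); rewrite rkF.
have sTp : clp T \subset p.2.
  case: (eqVneq T set0) => [->|Tn0]; first by rewrite clp_0 sub0set.
  have qX : (setT, clp T) \in ext_upto m.
    by apply/ext_uptoP; left; apply: split_biflag_right.
  have /orP[/andP[]//|/andP[s _]] := biflag_compatible bpX pX (sX _ qX).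
  by rewrite subTset (negPf pnT) in s.
case/negP: pp0; rewrite eF p1F; suff -> : (if partial_cover m.+1 then clp T else setT) = p.2.
  by case: (p).
case: ifP => cov; last first.
  apply/esym; case: (leqP (rkp p.2) (n - r - 1)) => [leT|gtT].
    have eT : clp T = p.2 by apply: (flat_rk_eq bases'_matroid fT sTp); rewrite rkT.
    case/and5P: bp => _ _ _ _ /andP[_]; rewrite -p1F -eT => cov'.
    by rewrite /partial_cover cov' in cov.
  apply/eqP; apply: contraTT gtT => nT; rewrite -leqNgt.
  exact/leq_sub1/(flat_rk_lt bases'_matroid bases'_card (biflat_flatp bp) nT).
apply: (flat_rk_eq bases'_matroid fT sTp); rewrite rkT leqNgt; apply/negP => gtT.
have p2T : p.2 = setT.
  apply/eqP; apply: contraTT gtT => nT; rewrite -leqNgt.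
  exact/leq_sub1/(flat_rk_lt bases'_matroid bases'_card (biflat_flatp bp) nT).
have /set0Pn[e /uncoveredP eX] := biflag_uncovered bpX.
have : e \in cl (partial_basis m.+1) :|: clp T by rewrite (eqP cov) inE.
rewrite in_setU => /orP[eF'|eT].
  by apply: (eX p pX); rewrite ?p2T ?inE // -p1F.
have Tn0 : T != set0 by apply: contraTneq eT => ->; rewrite clp_0 inE.
have qX : (setT, clp T) \in ext_upto m.
  by apply/ext_uptoP; left; apply: split_biflag_right.
by apply: (eX _ (sX _ qX)); [rewrite in_setT | exact: eT].
Qed.

Lemma gam_ext_biflag : (gam i ^+ k * xmon (split_biflag S T) === xmon (ext_biflag bases r k B))%R.
Proof.
rewrite -ext_upto_max; suff ext m : m <= k ->
    (gam i ^+ k * xmon (split_biflag S T) === gam i ^+ (k - m) * xmon (ext_upto m))%R.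
  by have := ext k (leqnn k); rewrite subnn expr0 mul1r.
elim: m => [_|m IHm lt]; first by rewrite subn0; apply: chow_refl.
exact: chow_trans (IHm (ltnW lt)) (gam_extend lt).
Qed.

End Extension.

(** * Matching the expansion with the sum over nbc bases *)

Definition nbc_with_activity B : bool := nbc_basis bases B && (#|IA bases B| == k.+1).

Lemma nbc_with_activityP B : nbc_with_activity B ->
  [/\ B \in bases, EA bases B = set0, #|IA bases B| = k.+1,
      #|SB B| = r - k & #|TB B| = n - r - 1].
Proof.
case/andP=> /andP[bB /eqP nB] /eqP cB; split=> //.
  exact: (card_SB bases_matroid bases_card bB k_le_r cB).
exact: (card_TB bases_card coloopless bB).
Qed.

Local Notation ext_sum S T :=
  (\sum_(B | nbc_with_activity B && compatible_split bases B S T)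
    xmon (ext_biflag bases r k B))%R.

Lemma ext_sum0 S T : (forall B, nbc_with_activity B -> ~~ compatible_split bases B S T) ->
  ext_sum S T = 0%R.
Proof. by move=> h; apply: big_pred0 => B; apply: contraTF isT => /andP[/h/negP]. Qed.

Lemma compatible_cards B S T : nbc_with_activity B -> compatible_split bases B S T ->
  #|S| <= r - k /\ #|T| <= n - r - 1.
Proof.
move=> /nbc_with_activityP[_ _ _ <- <-] /and3P[sS sT _].
by split; apply: subset_leq_card.
Qed.

Lemma large_left_vanishes N S T : indep S -> r - k < #|S| ->
  vanishes (weight N (split_biflag S T)).
Proof.
move=> iS lt; have Sn0 : S != set0 by rewrite -card_gt0; apply: leq_trans lt.
have SX := split_biflag_left T Sn0.
case: (eqVneq (cl S) setT) => [e|SnT].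
  by apply/vanishesM/xmon_notbiflag/setT_setT_not_biflag; rewrite -{1}e.
rewrite mulrAC mulrC; apply: vanishesM.
apply: (gam_kills R bases_matroid bases_card i SX SnT) => /=.
rewrite (rk_cl bases_matroid bases_card) (rk_indep bases_matroid iS).
by move: lt k_le_r; move: #|S| => s; clear; lia.
Qed.

(** An independent set of this size spans the dual, which puts $E|E$, not a biflat, into the set. *)
Lemma large_right_vanishes N S T : indepp T -> n - r - 1 < #|T| ->
  vanishes (weight N (split_biflag S T)).
Proof.
move=> iT lt; have Tn0 : T != set0 by rewrite -card_gt0; apply: leq_trans lt.
apply/vanishesM/xmon_notbiflag/setT_setT_not_biflag.
suff {2}<- : clp T = setT by apply: split_biflag_right.
apply/eqP; apply: contraTT lt => TnT; rewrite -leqNgt.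
have := flat_rk_lt bases'_matroid bases'_card (cl_flat bases'_matroid bases'_card T) TnT.
rewrite (rk_cl bases'_matroid bases'_card) (rk_indep bases'_matroid iT).
by move: #|T| => t; clear; lia.
Qed.

(** Both sides obey the same recursion in the next label: monomials branch by [del_split], and
    compatible bases by [compatible_next]. *)
Lemma weight_split_biflag N S T : indep S -> indepp T -> [disjoint S & T] ->
  greedy_split bases S T -> #|S| + #|T| + N = n - k - 1 ->
  weight N (split_biflag S T) === ext_sum S T.
Proof.
elim: N S T => [|N IHN] S T iS iT dST gST eN.
(* Too many labels on one side, or an empty gap: the monomial vanishes and no basis is compatible.
   These cases are settled for zero and positive [N] together. *)
all: have [leS|ltS] := leqP #|S| (r - k); last first.
1,3: rewrite ext_sum0; [exact/vanishes_chow0/large_left_vanishes|].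
1,2: by move=> B aB; apply: contraTN ltS => /(compatible_cards aB)[]; rewrite -leqNgt.
all: have [leT|ltT] := leqP #|T| (n - r - 1); last first.
1,3: rewrite ext_sum0; [exact/vanishes_chow0/large_right_vanishes|].
1,2: by move=> B aB; apply: contraTN ltT => /(compatible_cards aB)[]; rewrite -leqNgt.
all: case: (set_0Vmem (gap S T)) => [g0|[z zg]].
1,3: rewrite ext_sum0; [apply/vanishes_chow0/vanishesM/xmon_notbiflag|].
1,3: by apply/negP => /biflag_uncovered; rewrite uncovered_split_biflag g0 eqxx.
1,2: move=> B /nbc_with_activityP[bB nB _ _ _]; apply/negP.
1,2: by move/(compatible_gap bases_matroid bases_card coloopless bB nB); rewrite g0 eqxx.
all: case: (arg_maxnP (@nat_of_ord _) zg) => e eg emax {z zg}.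
  (* With no $\delta$ left, the two upper bounds add up to exactly the number of labels. *)
  have [cS cT] : #|S| = r - k /\ #|T| = n - r - 1.
    by move: leS leT eN r_lt_n k_le_r; move: #|S| #|T| => s t; clear; lia.
  have [] := nbc_of_greedy bases_matroid bases_card coloopless gST dST iS iT cT eg emax.
  set B0 := ~: _ => nB0 eS eT.
  have [bB0 /eqP EA0] := andP nB0.
  have cIA : #|IA bases B0| = k.+1.
    have := cS; rewrite -eS cardsD (bases_card bB0) (setIidPr _).
      have : #|IA bases B0| <= r.+1.
        rewrite -(bases_card bB0) subset_leq_card //; apply/subsetP => x.
        by rewrite (mem_IA bases_matroid bases_card _ bB0) => /andP[].
      by move: k_le_r; move: #|IA _ _| => a; clear; lia.
    by apply/subsetP => x; rewrite (mem_IA bases_matroid bases_card _ bB0) => /andP[].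
  have -> : ext_sum S T = xmon (ext_biflag bases r k B0).
    apply: big_pred1 => B; apply/andP/eqP => [[aB cB]|->].
      have [bB nB _ cSB cTB] := nbc_with_activityP aB.
      have [eSB eTB] : S = SB B /\ T = TB B.
        by apply: (compatible_full cB); rewrite cSB cTB cS cT.
      rewrite eSB eTB in eg emax.
      rewrite (nbc_determined bases_matroid bases_card coloopless bB nB emax eg).
      by rewrite /B0 eTB.
    split; first by rewrite /nbc_with_activity nB0 cIA eqxx.
    apply/and3P; rewrite eS eT !subxx; split=> //.
    by apply/forall_inP => x; rewrite setDv inE.
  rewrite expr0 mulr1 -{1}eS -{1}eT.
  exact: gam_ext_biflag bB0 cIA.
have lt := greedy_lt bases_matroid bases_card gST eg.
have SnT : cl S != setT.
  apply: (cl_neqT bases_matroid bases_card iS); apply: leq_ltn_trans leS _.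
  by rewrite ltnS leq_subr.
have [neS neT] := gapP _ _ _ _ eg.
have := gap_notin eg; rewrite inE negb_or => /andP[enS enT].
have eNS : #|e |: S| + #|T| + N = n - k - 1.
  by rewrite cardsU1 enS -eN add1n !addSn addnS.
have eNT : #|S| + #|e |: T| + N = n - k - 1.
  by rewrite cardsU1 enT -eN add1n !addnS !addSn.
apply: chow_trans (del_split iS iT dST SnT eN eg lt) _.
have -> : ext_sum S T = (ext_sum (e |: S) T + ext_sum S (e |: T))%R.
  rewrite (bigID (fun B => compatible_split bases B (e |: S) T)) /=.
  have next B : nbc_with_activity B -> compatible_split bases B S T ->
      compatible_split bases B (e |: S) T (+) compatible_split bases B S (e |: T).
    move=> /nbc_with_activityP[bB nB _ cSB cTB] cB.
    apply: (compatible_next bases_matroid bases_card coloopless bB nB cB) => //.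
    rewrite cSB cTB; have : #|S| + #|T| < n - k - 1 by rewrite -eN addnS ltnS leq_addr.
    by move: r_lt_n k_le_r; move: #|S| #|T| => s t; clear; lia.
  have prevl B := @compatible_prev_l _ bases B S T e lt.
  have prevr B := @compatible_prev_r _ bases B S T e lt.
  congr (_ + _)%R; apply: eq_bigl => B; rewrite -andbA; case: (boolP (nbc_with_activity B)) => //= aB.
    by apply: andb_idl; apply: prevl.
  apply/andP/idP => [[cB /negPf cl0]|cB]; first by have := next _ aB cB; rewrite cl0.
  split; first exact: prevr.
  by have := next _ aB (prevr _ cB); rewrite cB; case: (compatible_split _ _ _ _).
apply: chowD; apply: IHN => //.
- exact: (indep_setU1 bases_matroid bases_card).
- by rewrite -setI_eq0 setIUl setU_eq0 !setI_eq0 disjoints1 enT.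
- by apply: (greedy_next bases_matroid bases_card gST eg emax); rewrite ?setUA //; [right|left].
- exact: (indep_setU1 bases'_matroid bases'_card).
- by rewrite disjoint_sym -setI_eq0 setIUl setU_eq0 !setI_eq0 disjoints1 enS disjoint_sym.
- by apply: (greedy_next bases_matroid bases_card gST eg emax); rewrite 1?setUCA //; [left|right].
Qed.

End Expansion.

Local Open Scope ring_scope.

Theorem theorem1p1 (R : realType) (n r : nat) (bases : {set {set 'I_n.+1}}) :
  is_matroid_bases bases ->
  (forall B, B \in bases -> #|B| = r.+1) ->
  (forall x : 'I_n.+1, exists2 B, B \in bases & x \in B) ->
  (forall x : 'I_n.+1, exists2 B, B \in bases & x \notin B) ->
  forall k : nat, (k <= r)%N ->
  forall i j : 'I_n.+1,
  @chow_eq n bases R (gam bases R i ^+ k * del bases R j ^+ (n - k - 1))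
    (\sum_(B in [set B0 | nbc_basis bases B0 && (#|IA bases B0| == k.+1)])
        xmon bases R (ext_biflag bases r k B)).
Proof.
move=> bases_matroid bases_card loopless coloopless k k_le_r i j.
have i0 : indep bases set0.
  have /set0Pn[B bB] := bases_matroid.1.
  by apply/indepP; exists B; rewrite ?sub0set.
have i0' : indep (dual_bases bases) set0.
  have /set0Pn[B bB] := (dual_bases_matroid bases_matroid bases_card).1.
  by apply/indepP; exists B; rewrite ?sub0set.
have g0 : greedy_split bases set0 set0 by move=> e; rewrite setU0 inE.
have d0 : [disjoint (set0 : {set 'I_n.+1}) & set0] by rewrite -setI_eq0 setI0.
(* With empty label sets the split biflag is empty and every basis is compatible. *)
have := weight_split_biflag R bases_matroid bases_card loopless coloopless i j k_le_r
  i0 i0' d0 g0 (N := n - k - 1).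
rewrite !cards0 !add0n => /(_ erefl).
have -> : split_biflag bases set0 set0 = set0 by rewrite /split_biflag !imset0 setU0.
rewrite /xmon big_set0 mulr1 => h; apply: chow_trans h _.
rewrite (eq_bigl (fun B => B \in [set B0 | nbc_basis bases B0 && (#|IA bases B0| == k.+1)])).
  exact: chow_refl.
move=> B; rewrite inE /nbc_with_activity; apply: andb_idr => _; rewrite /compatible_split !sub0set /=.
by apply/forall_inP => x _; apply/forall_inP => y; rewrite setU0 inE.
Qed.
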